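(* Let $d>1$ be an integer and let $f\in\mathcal{D}(\mathbb{R}^d)'$ be a complex valued Schwartz distribution on $\mathbb{R}^d$. Assume that there exist a real number $\delta>0$ and a polynomial $q(z)=a_0+a_1z+\cdots+a_nz^n$ in one variable with complex coefficients and $a_n\neq 0$ such that $q(\tau_y)(f)=0$ for all $y\in\mathbb{R}^d$ with $\|y\|=\delta$, where $\|\cdot\|$ is the Euclidean norm. Then $f$ is, in the distributional sense, an ordinary polynomial. In particular, if $f$ is a continuous function, then it is an ordinary polynomial.
   Context: $\mathcal{D}(\mathbb{R}^d)'$ is the space of complex valued Schwartz distributions on $\mathbb{R}^d$. For $y\in\mathbb{R}^d$ the translation operator is defined on functions by $\tau_y(\phi)(x)=\phi(x+y)$ and on distributions by $\tau_y(f)\{\phi\}=f\{\tau_{-y}(\phi)\}$ for every test function $\phi$. For $q(z)=a_0+a_1z+\cdots+a_nz^n$, the distribution $q(\tau_y)(f)$ is $$q(\tau_y)(f)=\sum_{k=0}^n a_k(\tau_y)^k(f),$$ which for an ordinary function $f$ reads $q(\tau_y)(f)(x)=\sum_{k=0}^n a_kf(x+ky)$. An ordinary polynomial is a polynomial function with complex coefficients in $d$ real variables; a distribution is an ordinary polynomial in the distributional sense if it equals the distribution defined by such a function. *)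

(* Defs.v *)
From HB Require Import structures.
From mathcomp Require Import all_boot all_order all_algebra.
From mathcomp Require Import all_classical all_reals all_analysis.
From mathcomp Require Export complex.
(* Not imported: the notations of mpoly clash with those of MathComp-Analysis. *)
From mathcomp Require mpoly.

Set Implicit Arguments.
Unset Strict Implicit.
Unset Printing Implicit Defensive.

Import Order.TTheory GRing.Theory Num.Theory.
Import numFieldNormedType.Exports.

Local Open Scope classical_set_scope.
Local Open Scope ring_scope.
Local Open Scope complex_scope.

Section Distributions.
Variables (R : realType) (d : nat).
Implicit Types (x y : 'rV[R]_d) (phi psi : 'rV[R]_d -> R[i]).

(* The library norm `|x| on 'rV[R]_d is the sup norm: it gives the usual
   topology, but not the Euclidean spheres. *)
Definition eucl_norm x : R := Num.sqrt (\sum_i x ord0 i ^+ 2).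

(* [:: i1; ...; ik] |-> d/dx_i1 (... (d/dx_ik h)) *)
Definition partials (s : seq 'I_d) (h : 'rV[R]_d -> R) : 'rV[R]_d -> R :=
  foldr (fun i (k : 'rV[R]_d -> R) x => 'D_(delta_mx ord0 i) k x) h s.

Definition smooth (h : 'rV[R]_d -> R) : Prop :=
  forall s : seq 'I_d, continuous (partials s h) /\
    forall i x, derivable (partials s h) x (delta_mx ord0 i).

Definition Re_fun phi : 'rV[R]_d -> R := fun x => complex.Re (phi x).
Definition Im_fun phi : 'rV[R]_d -> R := fun x => complex.Im (phi x).

Definition cpartials (s : seq 'I_d) phi : 'rV[R]_d -> R[i] :=
  fun x => partials s (Re_fun phi) x +i* partials s (Im_fun phi) x.

Definition supp phi : set 'rV[R]_d := closure [set x | phi x != 0].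

Definition test_function phi : Prop :=
  [/\ smooth (Re_fun phi), smooth (Im_fun phi) & compact (supp phi)].

(* Functionals are total on functions 'rV[R]_d -> R[i]; only their values on
   test functions are meaningful, and every notion below only looks at those. *)
Definition functional := ('rV[R]_d -> R[i]) -> R[i].

(* A linear form on test functions such that, for each compact K, there are C
   and N with |f(phi)| <= C max_(|s| <= N) sup |d^s phi| whenever phi is
   supported in K; M below ranges over the upper bounds of that maximum. *)
Definition schwartz_distribution (f : functional) : Prop :=
  (forall (a : R[i]) phi psi, test_function phi -> test_function psi ->
     f (fun x => a * phi x + psi x) = a * f phi + f psi) /\
  (forall K : set 'rV[R]_d, compact K -> exists (C : R) (N : nat),
     forall phi (M : R), test_function phi -> supp phi `<=` K ->
       (forall s : seq 'I_d, (size s <= N)%N ->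
          forall x, `|cpartials s phi x| <= M%:C) ->
       `|f phi| <= (C * M)%:C).

Definition dist_eq (f g : functional) : Prop :=
  forall phi, test_function phi -> f phi = g phi.

Definition translate y phi : 'rV[R]_d -> R[i] := fun x => phi (x + y).

Definition dist_translate y (f : functional) : functional :=
  fun phi => f (translate (- y) phi).

Definition poly_translate (q : {poly R[i]}) y (f : functional) : functional :=
  fun phi => \sum_(k < size q) q`_k * iter k (dist_translate y) f phi.

Definition ordinary_polynomial (g : 'rV[R]_d -> R[i]) : Prop :=
  exists P : mpoly.mpoly d R[i],
    forall x, g x = mpoly.meval (fun i => (x ord0 i)%:C) P.

End Distributions.

(* The integral over R^d as an iterated Lebesgue integral. It is applied to
   continuous compactly supported integrands only, for which it is the integral
   with respect to d-dimensional Lebesgue measure by Fubini. *)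
Fixpoint integral_rV (R : realType) (d : nat) : ('rV[R]_d -> R) -> R :=
  match d with
  | 0 => fun h => h 0
  | d'.+1 => fun h : 'rV[R]_(1 + d') -> R =>
      Rintegral (@lebesgue_measure R) setT
        (fun t : R => integral_rV (fun v : 'rV[R]_d' => h (row_mx t%:M v)))
  end.

Definition dist_of_fun (R : realType) (d : nat) (g : 'rV[R]_d -> R[i]) :
    functional R d :=
  fun phi => integral_rV (Re_fun (fun x => g x * phi x))
          +i* integral_rV (Im_fun (fun x => g x * phi x)).

Definition dist_ordinary_polynomial (R : realType) (d : nat)
    (f : functional R d) : Prop :=
  exists2 g, ordinary_polynomial g & dist_eq f (dist_of_fun g).

(* Main.v *)
(** Differentiating q(tau_y) f = 0 as y runs along the sphere turns, for a tangent
    direction v, a relation h(tau_y) D_v^N f = 0 (for all y on the sphere and all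
    tangent v) into (z h')(tau_y) D_v^(N+2) f = 0: the extra factor D_v kills the
    term coming from the variation of v, since that term is h(tau_y) D_v^N applied
    to a radial derivative of f.  Hence each operator z d/dz - k raises N by 2, and
    applying those with k < n = deg q to q leaves a nonzero multiple of z^n.  As
    tau_y is invertible, D_v^(2n) f = 0 for every v tangent to the sphere, that is,
    since d > 1, for every v.

    It remains to see that a linear form f on test functions that kills all
    M-th powers of the coordinate derivatives is integration against a polynomial.
    In one coordinate a test function is a combination of M fixed test functions,
    weighted by its moments of order < M, plus the M-th derivative of a test
    function; doing this for the coordinates one after the other writes f as a
    linear combination of the functionals phi |-> integral of x^alpha phi.  *)
Require Import Defs.
From mathcomp Require Import all_boot all_order all_algebra.
From mathcomp Require Import all_classical all_reals all_analysis.
From mathcomp Require Import complex.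
From mathcomp Require Import ring lra.
(* Only the canonical instances: the notations clash with MathComp-Analysis. *)
From mathcomp Require Import (canonicals) mpoly.
Import Order.TTheory GRing.Theory Num.Theory.
Import numFieldNormedType.Exports.
Local Open Scope ring_scope.
Local Open Scope complex_scope.
Local Open Scope classical_set_scope.

Set Implicit Arguments.
Unset Strict Implicit.
Unset Printing Implicit Defensive.

(** The differentiation in y is carried out on numbers. For a fixed test function u, the pairing of
    the functional with a translate of u is a function of the parameter s of a circle, and only its
    first-order expansion at s = 0 with a quadratic remainder is used. The seminorm estimate of the
    distribution turns Taylor remainders of u, uniform in x together with their derivatives, into
    such numerical remainders.

    One coordinate plane at a time is enough: the circle of radius delta in the plane of the axes i
    and j lies on the sphere, and its tangent at delta e_i is along e_j. So d > 1 is used only to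
    find a partner i for each j.

    In the second half the obstacle is that the integral over R^d is iterated in a fixed order. The
    moments are therefore taken out in exactly that order. The resulting kernel is a finite sum of
    products of a function of x and a monomial in y, so the integrals over y become coefficients of
    finitely many fixed test functions of x, and linearity is all that the functional has to
    provide. *)

Section Continuity.
Variables (R : realType) (T : topologicalType).
Implicit Types h g : T -> R.

Lemma add_cont h g : continuous h -> continuous g -> continuous (fun t => h t + g t).
Proof. by move=> hc gc t; apply: continuousD; [exact: hc|exact: gc]. Qed.

Lemma sub_cont h g : continuous h -> continuous g -> continuous (fun t => h t - g t).
Proof. by move=> hc gc t; apply: continuousB; [exact: hc|exact: gc]. Qed.

Lemma mul_cont h g : continuous h -> continuous g -> continuous (fun t => h t * g t).
Proof. by move=> hc gc t; apply: continuousM; [exact: hc|exact: gc]. Qed.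

Lemma scale_cont h (c : R) : continuous h -> continuous (fun t => c * h t).
Proof. by apply: mul_cont; exact: cst_continuous. Qed.

End Continuity.

(** * Derivatives along lines and the mean value inequality *)

Section Lines.
Variables (R : realType) (V : normedModType R).
Implicit Types (h : V -> R) (x v : V).

Lemma is_derive_line h x v (s df : R) :
  is_derive (x + s *: v) v h df -> is_derive s 1 (fun r : R => h (x + r *: v)) df.
Proof.
move=> [hd hv].
have E : (fun t : R => t^-1 *:
    (((fun r : R => h (x + r *: v)) \o shift s) (t *: (1 : R)) - h (x + s *: v))) =
  (fun t : R => t^-1 *: ((h \o shift (x + s *: v)) (t *: v) - h (x + s *: v))).
  apply/funext => t /=; congr (_ *: (h _ - _)).
  by rewrite [t *: 1]mulr1 scalerDl addrCA addrC -addrA.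
split; first by rewrite /derivable E.
by rewrite -hv /derive E.
Qed.

Lemma derive_line h x v (df : R) :
  is_derive (0 : R) 1 (fun r : R => h (x + r *: v)) df -> is_derive x v h df.
Proof.
have E : (fun t : R => t^-1 *:
    (((fun r : R => h (x + r *: v)) \o shift 0) (t *: (1 : R)) - h (x + 0 *: v))) =
  (fun t : R => t^-1 *: ((h \o shift x) (t *: v) - h x)).
  apply/funext => t /=; rewrite scale0r !addr0; congr (_ *: (h _ - _)).
  by rewrite ?[t *: 1]mulr1 ?addr0 [RHS]addrC.
move=> [hd hv]; split; first by move: hd; rewrite /derivable E.
by rewrite -hv /derive E.
Qed.

Lemma mvt_abs (g dg : R -> R) (B s : R) :
  (forall r, is_derive (r : R) 1 g (dg r)) -> (forall r, `|r| <= `|s| -> `|dg r| <= B) ->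
  `|g s - g 0| <= B * `|s|.
Proof.
move=> gd dgB.
have gc : continuous g.
  by move=> r; apply/differentiable_continuous/derivable1_diffP; case: (gd r).
have [s0|s0] := leP 0 s.
  have [c cI ->] := MVT_segment s0 (fun r _ => gd r) (continuous_subspaceT gc).
  move: cI; rewrite subr0 normrM in_itv /= => /andP[c0 cs].
  by rewrite ler_wpM2r// dgB// !ger0_norm.
have [c cI E] := MVT_segment (ltW s0) (fun r _ => gd r) (continuous_subspaceT gc).
move: cI; rewrite distrC E sub0r normrM normrN in_itv /= => /andP[cs c0].
by rewrite ler_wpM2r// dgB// !ler0_norm ?lerN2// ltW.
Qed.

(** This is the tool for derivatives that the rules of calculus do not give: it serves with B = 0
    off a support, and also for integrals with a parameter and for the flat functions at 0. *)
Lemma is_derive_quad (g : R -> R) (a B : R) :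
  (forall s, `|s| <= 1 -> `|g s - g 0 - s * a| <= B * s ^+ 2) ->
  is_derive (0 : R) 1 g a.
Proof.
move=> gB.
have B0 : 0 <= B.
  by have := gB 1; rewrite normr1 lexx expr1n mulr1 => /(_ isT); apply: le_trans.
have lim : (fun t : R => t^-1 *: ((g \o shift 0) (t *: (1 : R)) - g 0)) @ 0^' --> a.
  apply/cvgrPdist_le => e e0; near=> t.
  have t0 : t != 0 by near: t; exact: nbhs_dnbhs_neq.
  rewrite /= addr0 [t *: 1]mulr1.
  have -> : a - t^-1 *: (g t - g 0) = - (t^-1 * (g t - g 0 - t * a)).
    by rewrite /GRing.scale /=; field.
  rewrite normrN normrM normfV ler_pdivrMl ?normr_gt0//.
  apply: (le_trans (gB t _)).
    near: t; apply: dnbhs0_le; exact: ltr01.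
  rewrite -real_normK ?num_real// expr2 mulrA mulrC ler_wpM2l//.
  (* The quotient is within B |t| of [a]; B + 1 is a positive divisor even when B = 0. *)
  have : `|t| <= e / (B + 1).
    near: t; apply: dnbhs0_le; rewrite divr_gt0//; lra.
  rewrite ler_pdivlMr; last lra.
  move: (normr_ge0 t); nra.
split; first by apply/cvg_ex; exists a.
by rewrite /derive; apply: cvg_lim.
Unshelve. all: by end_near. Qed.

End Lines.

(** * Smooth functions *)

Section Ck.
Variables (R : realType) (V : normedModType R) (I : Type) (e : I -> V).
Implicit Types f g : V -> R.

(** The recursion peels off the derivative taken first, which suits inductions on the order. The
    family [e] of directions covers both the basis of R^d and the single direction 1 of R. *)
Fixpoint Ck (n : nat) f : Prop :=
  continuous f /\
  if n is m.+1 then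
    forall i, (forall x, derivable f x (e i)) /\ Ck m (fun x => 'D_(e i) f x)
  else True.

Definition Cinf f := forall n, Ck n f.

Lemma Ck_cont n f : Ck n f -> continuous f. Proof. by case: n => [|n] []. Qed.

Lemma CkW n f : Ck n.+1 f -> Ck n f.
Proof.
elim: n f => [|n IH] f [fc fd]; first by split.
by split => // i; have [? ?] := fd i; split => //; exact: IH.
Qed.

Lemma CkS n f : continuous f ->
  (forall i, exists2 g, forall x, is_derive x (e i) f (g x) & Ck n g) -> Ck n.+1 f.
Proof.
move=> fc H; split => // i; have [g fg gn] := H i; split.
  by move=> x; case: (fg x).
by have -> // : (fun x => 'D_(e i) f x) = g; apply/funext => x; case: (fg x).
Qed.

Lemma CkS_derive n f i x : Ck n.+1 f -> is_derive x (e i) f ('D_(e i) f x).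
Proof. by case=> _ /(_ i)[fd _]; exact: derivableP. Qed.

Lemma Ck_cst n (c : R) : Ck n (fun=> c).
Proof.
elim: n c => [|n IH] c; first by split => //; exact: cst_continuous.
apply: CkS; first exact: cst_continuous.
move=> i; exists (fun=> 0); last exact: IH.
by move=> x; exact: is_derive_cst.
Qed.

Lemma CkD n f g : Ck n f -> Ck n g -> Ck n (fun x => f x + g x).
Proof.
elim: n f g => [|n IH] f g Hf Hg.
  by split => // x; apply: continuousD; [case: Hf => + _ | case: Hg => + _]; exact.
apply: CkS.
  by move=> x; apply: continuousD; [have := Ck_cont Hf|have := Ck_cont Hg]; exact.
move=> i; exists (fun x => 'D_(e i) f x + 'D_(e i) g x).
  by move=> x; apply: is_deriveD; apply: CkS_derive; eassumption.
by apply: IH; [case: Hf => _ /(_ i)[]|case: Hg => _ /(_ i)[]].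
Qed.

Lemma CkM n f g : Ck n f -> Ck n g -> Ck n (fun x => f x * g x).
Proof.
elim: n f g => [|n IH] f g Hf Hg.
  by split => // x; apply: continuousM; [case: Hf => + _ | case: Hg => + _]; exact.
apply: CkS.
  by move=> x; apply: continuousM; [have := Ck_cont Hf|have := Ck_cont Hg]; exact.
move=> i; exists (fun x => f x * 'D_(e i) g x + g x * 'D_(e i) f x).
  by move=> x; apply: is_deriveM; apply: CkS_derive; eassumption.
by apply: CkD; apply: IH; by [exact: CkW|case: Hf => _ /(_ i)[]|case: Hg => _ /(_ i)[]].
Qed.

Lemma CinfS f : continuous f ->
  (forall i, exists2 g, forall x, is_derive x (e i) f (g x) & Cinf g) -> Cinf f.
Proof.
move=> fc H [|n] //; apply: CkS => // i.
by have [g fg gi] := H i; exists g.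
Qed.

Lemma Cinf_D f i : Cinf f -> Cinf (fun x => 'D_(e i) f x).
Proof. by move=> H n; have [_ /(_ i)[]] := H n.+1. Qed.

Lemma Cinf_cont f : Cinf f -> continuous f. Proof. by move=> /(_ 0%N)/Ck_cont. Qed.

Lemma Cinf_derive f i x : Cinf f -> is_derive x (e i) f ('D_(e i) f x).
Proof. by move=> /(_ 1%N); exact: CkS_derive. Qed.

Lemma Cinf_cst (c : R) : Cinf (fun=> c). Proof. by move=> n; exact: Ck_cst. Qed.

Lemma CinfDr f g : Cinf f -> Cinf g -> Cinf (fun x => f x + g x).
Proof. by move=> Hf Hg n; exact: CkD. Qed.

Lemma CinfM f g : Cinf f -> Cinf g -> Cinf (fun x => f x * g x).
Proof. by move=> Hf Hg n; exact: CkM. Qed.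

Lemma CinfZ (c : R) f : Cinf f -> Cinf (fun x => c * f x).
Proof. by move=> Hf; apply: CinfM => //; exact: Cinf_cst. Qed.

Lemma Cinf_prod (J : Type) (r : seq J) (F : J -> V -> R) :
  (forall j, Cinf (F j)) -> Cinf (fun x => \prod_(j <- r) F j x).
Proof.
move=> HF; elim: r => [|j r IH].
  have -> : (fun x => \prod_(j <- [::]) F j x) = fun=> 1.
    by apply/funext => x; rewrite big_nil.
  exact: Cinf_cst.
have -> : (fun x => \prod_(j <- j :: r) F j x) = fun x => F j x * \prod_(j <- r) F j x.
  by apply/funext => x; rewrite big_cons.
exact: CinfM.
Qed.

End Ck.

Section OneDim.
Variable R : realType.
Implicit Types f g : R -> R.

Definition C1inf f := Cinf (fun _ : unit => 1 : R) f.

Lemma C1inf_D f : C1inf f -> C1inf (fun x : R => 'D_1 f x).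
Proof. by move=> H; exact: (Cinf_D tt H). Qed.

Lemma C1inf_derive f (x : R) : C1inf f -> is_derive x 1 f ('D_1 f x).
Proof. by move=> H; exact: (Cinf_derive tt x H). Qed.

Lemma C1inf_id : C1inf id.
Proof.
apply: CinfS => [x|_]; first exact: cvg_id.
by exists (fun=> 1); [move=> x; exact: is_derive_id|exact: Cinf_cst].
Qed.

Lemma C1inf_exp n : C1inf (fun x => x ^+ n).
Proof.
elim: n => [|n IH]; first exact: Cinf_cst.
under eq_fun do rewrite exprS.
by apply: CinfM => //; exact: C1inf_id.
Qed.

Lemma C1inf_affine f (a b : R) : C1inf f -> C1inf (fun x => f (a * x + b)).
Proof.
move=> Hf n; elim: n f Hf => [|n IH] f Hf.
  split => // x; apply: (@continuous_comp _ _ _ (fun x => a * x + b) f); last exact: (Cinf_cont Hf).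
  by apply: continuousD; [apply: continuousM; [exact: cst_continuous|exact: cvg_id]|exact: cst_continuous].
apply: CkS => [x|i].
  apply: (@continuous_comp _ _ _ (fun x => a * x + b) f); last exact: (Cinf_cont Hf).
  by apply: continuousD; [apply: continuousM; [exact: cst_continuous|exact: cvg_id]|exact: cst_continuous].
exists (fun x => a * 'D_1 f (a * x + b)).
  move=> x.
  have h1 : is_derive x 1 (fun x : R => a * x + b) a.
    have : is_derive x 1 (a \*: (@id R) + cst b) (a *: 1 + 0).
      by apply: is_deriveD.
    by rewrite addr0 /GRing.scale /= mulr1.
  have := @is_derive1_comp R f (fun x => a * x + b) x _ _ (C1inf_derive (a * x + b) Hf) h1.
  by rewrite mulrC.
apply: CkM; first exact: Ck_cst.
by apply: (IH (fun x => 'D_1 f x)); exact: C1inf_D.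
Qed.

End OneDim.

Lemma is_derive_mulr_cst (R : realType) (c r : R) : is_derive r 1 (fun x : R => x * c) c.
Proof.
have : is_derive r 1 (@id R * cst c) (r *: 0 + c *: 1) by apply: is_deriveM.
by rewrite scaler0 add0r /GRing.scale /= mulr1.
Qed.

(** * Real test functions on R^d *)

Section Test.
Variables (R : realType) (d : nat).
Local Notation V := 'rV[R]_d.
Implicit Types (h u : V -> R) (x y : V) (i j : 'I_d).

Definition E i : V := delta_mx ord0 i.
Definition D i h : V -> R := fun x => 'D_(E i) h x.
Definition smoothC h := Cinf E h.
(** Compact support is kept as an explicit radius, so that it can be followed through derivatives,
    shifts and integrals. *)
Definition vanish (A : R) h := forall x, A < `|x| -> h x = 0.
Definition Test h := smoothC h /\ exists A, vanish A h.

Lemma D_is_derive i h x (a : R) : is_derive x (E i) h a -> D i h x = a.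
Proof. by case. Qed.

Lemma coord_le_norm x i : `|x ord0 i| <= `|x|.
Proof.
rewrite [leRHS]/Num.norm /= mx_normrE; apply/bigmax_geP; right => /=.
by exists (ord0, i).
Qed.

Lemma norm_le_coord x (A : R) : 0 <= A -> (forall i, `|x ord0 i| <= A) -> `|x| <= A.
Proof.
move=> A0 H; rewrite [leLHS]/Num.norm /= mx_normrE; apply/bigmax_leP; split=> // -[a b] _ /=.
by rewrite ord1.
Qed.

Lemma norm_E i : `|E i| <= 1.
Proof.
apply: norm_le_coord => // j; rewrite mxE eqxx /=.
by case: (j == i); rewrite ?normr1 // normr0.
Qed.

Lemma vanishW (A B : R) h : A <= B -> vanish A h -> vanish B h.
Proof. by move=> AB H x Bx; apply: H; exact: le_lt_trans Bx. Qed.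

Lemma vanish_coord (A : R) h x i : vanish A h -> A < `|x ord0 i| -> h x = 0.
Proof. by move=> H Ax; apply: H; exact: lt_le_trans Ax (coord_le_norm _ _). Qed.

Lemma smoothC_line h i x (s : R) : smoothC h ->
  is_derive s 1 (fun r : R => h (x + r *: E i)) (D i h (x + s *: E i)).
Proof. by move=> Hh; apply: is_derive_line; exact: (Cinf_derive i _ Hh). Qed.

Lemma smoothC_D i h : smoothC h -> smoothC (D i h). Proof. exact: Cinf_D. Qed.

(** The radius grows by 1 because [is_derive_quad] examines steps of length up to 1, and these must
    stay off the ball. *)
Lemma vanish_D (A : R) i h : vanish A h -> vanish (A + 1) (D i h).
Proof.
move=> Ah x Ax; apply: D_is_derive; apply: derive_line; apply: (@is_derive_quad R _ 0 0) => s s1.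
have z r : `|r| <= 1 -> h (x + r *: E i) = 0.
  move=> r1; apply: Ah.
  have : `|x| <= `|x + r *: E i| + `|r *: E i|.
    by rewrite -{1}(addrK (r *: E i) x); exact: ler_normB.
  have : `|r *: E i| <= 1.
    by rewrite normrZ -[leRHS]mulr1 ler_pM// norm_E.
  lra.
by rewrite !z ?normr0// mulr0 !subr0 normr0 mul0r.
Qed.

Lemma Test_D i h : Test h -> Test (D i h).
Proof.
move=> [Hh [A Ah]]; split; first exact: smoothC_D.
by exists (A + 1); exact: vanish_D.
Qed.

Lemma Test_iterD n i u : Test u -> Test (iter n (D i) u).
Proof. by move=> Hu; elim: n => //= n; exact: Test_D. Qed.

Lemma Test_add h u : Test h -> Test u -> Test (fun x => h x + u x).
Proof.
move=> [Hh [A Ah]] [Hu [B Bu]]; split; first exact: CinfDr.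
exists (Num.max A B) => x; rewrite gt_max => /andP[Ax Bx].
by rewrite Ah// Bu// addr0.
Qed.

Lemma Test_mul h u : smoothC h -> Test u -> Test (fun x => h x * u x).
Proof.
move=> Hh [Hu [B Bu]]; split; first exact: CinfM.
by exists B => x Bx; rewrite Bu// mulr0.
Qed.

Lemma Test_scale (c : R) u : Test u -> Test (fun x => c * u x).
Proof. by move=> Hu; apply: Test_mul => //; exact: Cinf_cst. Qed.

Lemma Test_sub h u : Test h -> Test u -> Test (fun x => h x - u x).
Proof.
move=> Hh /(Test_scale (-1)) Hu.
by have := Test_add Hh Hu; under eq_fun do rewrite mulN1r.
Qed.

Lemma Test_0 : Test (fun=> 0).
Proof. by split; [exact: Cinf_cst|exists 0]. Qed.

Lemma D_add i h u : smoothC h -> smoothC u -> D i (fun x => h x + u x) = fun x => D i h x + D i u x.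
Proof.
move=> Hh Hu; apply/funext => x; apply: D_is_derive.
by apply: is_deriveD; exact: Cinf_derive.
Qed.

Lemma D_mul i h u : smoothC h -> smoothC u ->
  D i (fun x => h x * u x) = fun x => h x * D i u x + u x * D i h x.
Proof.
move=> Hh Hu; apply/funext => x; apply: D_is_derive.
by apply: is_deriveM; exact: Cinf_derive.
Qed.

Lemma D_cst i (c : R) : D i (fun=> c) = fun=> 0.
Proof. by apply/funext => x; exact: derive_cst. Qed.

Lemma D_scale i (c : R) u : smoothC u -> D i (fun x => c * u x) = fun x => c * D i u x.
Proof.
move=> Hu; rewrite D_mul//; last exact: Cinf_cst.
by apply/funext => x; rewrite D_cst mulr0 addr0.
Qed.

Lemma D_sub i h u : smoothC h -> smoothC u -> D i (fun x => h x - u x) = fun x => D i h x - D i u x.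
Proof.
move=> Hh Hu; have := D_add i Hh (CinfZ (-1) Hu); rewrite D_scale//.
by under eq_fun do rewrite mulN1r; under [X in _ = X -> _]eq_fun do rewrite mulN1r.
Qed.

Lemma smoothC_shift h y : smoothC h -> smoothC (fun x => h (x + y)).
Proof.
move=> H n; elim: n h H => [|n IH] h H.
  split => // x; apply: (@continuous_comp _ _ _ (fun x => x + y) h).
    by apply: continuousD; [exact: cvg_id|exact: cst_continuous].
  exact: (Cinf_cont H).
apply: CkS => [x|i].
  apply: (@continuous_comp _ _ _ (fun x => x + y) h).
    by apply: continuousD; [exact: cvg_id|exact: cst_continuous].
  exact: (Cinf_cont H).
exists (fun x => D i h (x + y)); last by apply: IH; exact: smoothC_D.
move=> x; apply: derive_line.
have := smoothC_line i (x + y) 0 H; rewrite scale0r addr0.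
by under eq_fun do rewrite addrAC.
Qed.

Lemma D_shift i h y : smoothC h -> D i (fun x => h (x + y)) = fun x => D i h (x + y).
Proof.
move=> H; apply/funext => x.
apply: D_is_derive; apply: derive_line.
have := smoothC_line i (x + y) 0 H; rewrite scale0r addr0.
by under eq_fun do rewrite addrAC.
Qed.

Lemma Test_shift h y : Test h -> Test (fun x => h (x + y)).
Proof.
move=> [Hh [A Ah]]; split; first exact: smoothC_shift.
exists (A + `|y|) => x Ax; apply: Ah.
have : `|x| <= `|x + y| + `|y| by rewrite -{1}(addrK y x); exact: ler_normB.
by move: Ax; lra.
Qed.

Lemma closed_ball0 (A : R) : closed [set x : V | `|x| <= A].
Proof.
rewrite (_ : [set x | _] = (fun x : V => `|x|) @^-1` [set r | r <= A]) //.
by apply: preimage_closed; [move=> x _; exact: norm_continuous|exact: closed_le].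
Qed.

Lemma compact_ball0 (A : R) : compact [set x : V | `|x| <= A].
Proof.
apply: bounded_closed_compact; last exact: closed_ball0.
by exists A; split; [exact: num_real|move=> M AM x /= xA; exact: le_trans (ltW AM)].
Qed.

Lemma cont_bounded h (A : R) : continuous h -> vanish A h ->
  exists2 B, 0 <= B & forall x, `|h x| <= B.
Proof.
move=> hc Ah.
have K := @compact_ball0 A.
have /compact_bounded[M [_ HM]] : compact (h @` [set x : V | `|x| <= A]).
  by apply: continuous_compact => //; exact: continuous_subspaceT.
exists (`|M| + 1); first by have := normr_ge0 M; lra.
move=> x; have [xA|Ax] := leP `|x| A.
  by apply: (HM (`|M| + 1)); [have := ler_norm M; lra|exists x].
by rewrite Ah// normr0; have := normr_ge0 M; lra.
Qed.

Lemma Test_bounded h : Test h -> exists2 B, 0 <= B & forall x, `|h x| <= B.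
Proof. by move=> [Hh [A Ah]]; exact: cont_bounded (Cinf_cont Hh) Ah. Qed.

Lemma Test_lip i h : Test h -> exists2 B, 0 <= B &
  forall x (s : R), `|h (x + s *: E i) - h x| <= B * `|s|.
Proof.
move=> Hh; have [B B0 HB] := Test_bounded (Test_D i Hh); exists B => // x s.
have := @mvt_abs R (fun r => h (x + r *: E i)) (fun r => D i h (x + r *: E i)) B s.
by rewrite scale0r addr0; apply => // r; exact: (smoothC_line i x r Hh.1).
Qed.

(** Mean value inequality for r |-> h(x + r e_i) - r D_i h(x), whose derivative is bounded by a
    Lipschitz constant of D_i h times |s|. The uniformity in x is what the estimates for functionals
    rely on. *)
Lemma Test_quad i h : Test h -> exists2 B, 0 <= B &
  forall x (s : R), `|h (x + s *: E i) - h x - s * D i h x| <= B * s ^+ 2.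
Proof.
move=> Hh; have [B B0 HB] := Test_lip i (Test_D i Hh); exists B => // x s.
have := @mvt_abs R (fun r => h (x + r *: E i) - r * D i h x)
  (fun r => D i h (x + r *: E i) - D i h x) (B * `|s|) s.
rewrite scale0r addr0 mul0r subr0 addrAC -mulrA -expr2 real_normK ?num_real//; apply.
  move=> r; apply: is_deriveB; first exact: (smoothC_line i x r Hh.1).
  exact: is_derive_mulr_cst.
by move=> r rs; apply: (le_trans (HB _ _)); rewrite ler_wpM2l.
Qed.

(** The second difference of h over a square of side s is symmetric in the two directions and equals
    s^2 times either mixed derivative up to O(s^3); divide by s^2 and let s tend to 0. *)
Lemma D_comm i j h : Test h -> D i (D j h) = D j (D i h).
Proof.
move=> Hh; apply/funext => x.
have key a b : exists2 C, 0 <= C & forall s : R,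
    `|h (x + s *: E a + s *: E b) - h (x + s *: E a) - h (x + s *: E b) + h x
      - s ^+ 2 * D b (D a h) x| <= C * `|s| ^+ 3.
  have [B B0 HB] := Test_quad b (Test_D a Hh).
  have [C C0 HC] := Test_lip a (Test_D b (Test_D a Hh)).
  exists (B + C); first lra.
  move=> s.
  (* g s - g 0 is the second difference minus its main term. The derivative of g is a Taylor
     remainder in direction b plus s times the variation of D_b D_a h along direction a. *)
  pose g r := h (x + s *: E b + r *: E a) - h (x + r *: E a) - r * (s * D b (D a h) x).
  have -> : h (x + s *: E a + s *: E b) - h (x + s *: E a) - h (x + s *: E b) + h x
      - s ^+ 2 * D b (D a h) x = g s - g 0.
    rewrite /g !scale0r !addr0 mul0r subr0 [x + s *: E a + s *: E b]addrAC; ring.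
  have := @mvt_abs R g
    (fun r => D a h (x + s *: E b + r *: E a) - D a h (x + r *: E a) - s * D b (D a h) x)
    ((B + C) * `|s| ^+ 2) s.
  have -> : (B + C) * `|s| ^+ 2 * `|s| = (B + C) * `|s| ^+ 3 by rewrite -mulrA -exprSr.
  apply=> [r|r rs].
    apply: is_deriveB; last exact: is_derive_mulr_cst.
    by apply: is_deriveB; exact: (smoothC_line a _ r Hh.1).
  have q := HB (x + r *: E a) s; have l := HC x r.
  have -> : x + s *: E b + r *: E a = x + r *: E a + s *: E b by rewrite addrAC.
  set u := D a h _ - D a h _; rewrite -/u in q.
  have -> : u - s * D b (D a h) x = (u - s * D b (D a h) (x + r *: E a)) +
      s * (D b (D a h) (x + r *: E a) - D b (D a h) x).
    by move: (D b _ _) (D b _ _) => v w; ring.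
  apply: (le_trans (ler_normD _ _)); rewrite mulrDl; apply: lerD.
    by rewrite real_normK ?num_real.
  rewrite normrM expr2 mulrCA ler_wpM2l// (le_trans l)// ler_wpM2l//.
have [C C0 HC] := key i j; have [B B0 HB] := key j i.
apply/eqP; rewrite -subr_eq0 -normr_le0; apply/ler_addgt0Pr => e e0; rewrite add0r.
pose s := e / (B + C + 1).
have s0 : 0 < s by rewrite divr_gt0//; lra.
have sE : (B + C) * s = e - s.
  have -> : e = s * (B + C + 1) by rewrite /s divfK// gt_eqF//; lra.
  ring.
clearbody s.
have {HC} := HC s; have {HB} := HB s.
have -> : x + s *: E j + s *: E i = x + s *: E i + s *: E j by rewrite addrAC.
set p := h _; set q := h _; set r := h _; set t := h _; set a := D i _ _; set b := D j _ _.
rewrite (gtr0_norm s0) => HB HC.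
have : s ^+ 2 * `|a - b| <= (B + C) * s ^+ 3.
  have -> : s ^+ 2 * `|a - b| = `|s ^+ 2 * (a - b)| by rewrite normrM ger0_norm// exprn_ge0// ltW.
  have -> : s ^+ 2 * (a - b) = (p - r - q + t - s ^+ 2 * b) - (p - q - r + t - s ^+ 2 * a) by ring.
  by rewrite mulrDl [leRHS]addrC; apply: (le_trans (ler_normB _ _)); apply: lerD.
rewrite [s ^+ 3]exprSr [leRHS]mulrCA ler_pM2l ?exprn_gt0// => /le_trans; apply.
by rewrite sE gerBl ltW.
Qed.

(** Move along i, then along j; besides the two one-dimensional remainders there is the change of
    D_j h between the two base points, of size |a b|. *)
Lemma Test_quad2 i j h : Test h -> exists2 B, 0 <= B & forall x (a b : R),
  `|h (x + a *: E i + b *: E j) - h x - a * D i h x - b * D j h x| <= B * (a ^+ 2 + b ^+ 2).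
Proof.
move=> Hh; have [B B0 HB] := Test_quad i Hh; have [C C0 HC] := Test_quad j Hh.
have [L L0 HL] := Test_lip i (Test_D j Hh).
exists (B + C + L); first lra.
move=> x a b.
have -> : h (x + a *: E i + b *: E j) - h x - a * D i h x - b * D j h x =
  (h (x + a *: E i) - h x - a * D i h x) +
  (h (x + a *: E i + b *: E j) - h (x + a *: E i) - b * D j h (x + a *: E i)) +
  b * (D j h (x + a *: E i) - D j h x).
  by move: (h _) (h _) (h _) (D _ _ _) (D _ _ _) (D _ _ _) => *; ring.
apply: (le_trans (ler_normD _ _)).
apply: (@le_trans _ _ ((B * a ^+ 2 + C * b ^+ 2) + L * (a ^+ 2 + b ^+ 2))).
  apply: lerD.
    by apply: (le_trans (ler_normD _ _)); apply: lerD; [exact: HB|exact: HC].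
  rewrite normrM.
  apply: (@le_trans _ _ (`|b| * (L * `|a|))); first by rewrite ler_wpM2l.
  rewrite -[a ^+ 2]real_normK ?num_real// -[b ^+ 2]real_normK ?num_real//.
  have := normr_ge0 a; have := normr_ge0 b; set p := `|a|; set q := `|b| => q0 p0.
  rewrite mulrCA ler_wpM2l//; nra.
have := sqr_ge0 a; have := sqr_ge0 b; nra.
Qed.

Lemma smoothP h : smooth h <-> smoothC h.
Proof.
split => [H n|H].
  elim: n h H => [|n IH] h H; first by split => //; have [] := H [::].
  split => [|i]; first by have [] := H [::].
  split; first by have [_ /(_ i)] := H [::].
  (* [partials] adds derivatives on the outside and [Ck] on the inside, so the new index goes to the
     end of the sequence. *)
  apply: IH => s; have := H (rcons s i).
  by rewrite /partials -cats1 foldr_cat.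
have S s : smoothC (partials s h) by elim: s => //= i s IH; exact: smoothC_D.
move=> s; split; first exact: Cinf_cont (S s).
by move=> i x; have [] := Cinf_derive i x (S s).
Qed.

End Test.

(** * Differentiation along the sphere *)

Section FirstOrder.
Variable R : realType.
Implicit Types (K L r : R -> R[i]) (A B : R[i]).

Definition bounded1 r := exists c : R[i], forall s : R, `|s| <= 1 -> `|r s| <= c.

Lemma bounded1_cst A : bounded1 (fun=> A).
Proof. by exists `|A|. Qed.

Lemma bounded1_id : bounded1 (fun s => s%:C).
Proof.
exists 1 => s s1; rewrite normc_def /= expr0n addr0 sqrtr_sqr.
by rewrite (_ : 1 = 1%:C :> R[i])// lecR.
Qed.

Lemma bounded1D K L : bounded1 K -> bounded1 L -> bounded1 (fun s => K s + L s).
Proof.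
move=> [a Ka] [b Lb]; exists (a + b) => s s1.
by apply: (le_trans (ler_normD _ _)); apply: lerD; [exact: Ka|exact: Lb].
Qed.

Lemma bounded1M K L : bounded1 K -> bounded1 L -> bounded1 (fun s => K s * L s).
Proof.
move=> [a Ka] [b Lb]; exists (a * b) => s s1.
by rewrite normrM ler_pM//; [exact: Ka|exact: Lb].
Qed.

(** A substitute for differentiability at s = 0 of a complex-valued function; with a bounded
    remainder, sums and products reduce to algebra. *)
Definition taylor1 K A B := exists2 r, bounded1 r &
  forall s : R, `|s| <= 1 -> K s = A + s%:C * B + s%:C ^+ 2 * r s.

Lemma taylor1_eq K A B A' B' : taylor1 K A B -> A = A' -> B = B' -> taylor1 K A' B'.
Proof. by move=> H <- <-. Qed.

Lemma taylor1_cst A : taylor1 (fun=> A) A 0.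
Proof.
exists (fun=> 0); first exact: bounded1_cst.
by move=> s _; rewrite !mulr0 !addr0.
Qed.

Lemma taylor1D K L A B A' B' : taylor1 K A B -> taylor1 L A' B' ->
  taylor1 (fun s => K s + L s) (A + A') (B + B').
Proof.
move=> [r rb rE] [q qb qE]; exists (fun s => r s + q s); first exact: bounded1D.
by move=> s s1; rewrite rE// qE//; ring.
Qed.

Lemma taylor1M K L A B A' B' : taylor1 K A B -> taylor1 L A' B' ->
  taylor1 (fun s => K s * L s) (A * A') (A * B' + B * A').
Proof.
move=> [r rb rE] [q qb qE].
exists (fun s => B * B' + A * q s + A' * r s + s%:C * (B * q s + B' * r s) +
  s%:C * s%:C * (r s * q s)).
  have cM a K' : bounded1 K' -> bounded1 (fun s => a * K' s).
    by move=> H; apply: bounded1M => //; exact: bounded1_cst.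
  apply: bounded1D; last first.
    by apply: bounded1M; [apply: bounded1M; exact: bounded1_id|exact: bounded1M].
  apply: bounded1D; last first.
    by apply: bounded1M; [exact: bounded1_id|apply: bounded1D; exact: cM].
  by apply: bounded1D; [apply: bounded1D; [exact: bounded1_cst|exact: cM]|exact: cM].
by move=> s s1; rewrite rE// qE//; move: s%:C => z; ring.
Qed.

Lemma taylor1Z c K A B : taylor1 K A B -> taylor1 (fun s => c * K s) (c * A) (c * B).
Proof.
by move=> H; apply: (taylor1_eq (taylor1M (taylor1_cst c) H)) => //; rewrite mul0r addr0.
Qed.

Lemma taylor1_sum n (K : nat -> R -> R[i]) (A B : nat -> R[i]) :
  (forall k, taylor1 (K k) (A k) (B k)) ->
  taylor1 (fun s => \sum_(k < n) K k s) (\sum_(k < n) A k) (\sum_(k < n) B k).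
Proof.
move=> H; elim: n => [|n IH].
  rewrite !big_ord0; under eq_fun do rewrite big_ord0; exact: taylor1_cst.
rewrite !big_ord_recr; under eq_fun do rewrite big_ord_recr; exact: taylor1D.
Qed.

Lemma taylor1_bound K (c : R) : (forall s, `|s| <= 1 -> `|K s| <= (c * s ^+ 2)%:C) ->
  taylor1 K 0 0.
Proof.
move=> H; exists (fun s => K s / s%:C ^+ 2).
  exists c%:C => s s1; have [->|s0] := eqVneq s 0.
    rewrite expr0n /= invr0 mulr0 normr0 ler0c.
    have := H 1; rewrite normr1 lexx expr1n mulr1 => /(_ isT)/(le_trans (normr_ge0 _)).
    by rewrite ler0c.
  rewrite normrM normfV ler_pdivrMr; last first.
    by rewrite normr_gt0 expf_neq0 // -[0]/(0%:C) (inj_eq (@complexI R)).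
  apply: (le_trans (H s s1)); rewrite -rmorphXn /= normc_def /= expr0n addr0 sqrtr_sqr.
  by rewrite ger0_norm ?sqr_ge0// -rmorphM.
move=> s s1; rewrite add0r mulr0 add0r; have [s0|s0] := eqVneq s 0.
  have := H s s1; rewrite s0 expr0n mulr0 normr_le0 => /eqP ->.
  by rewrite mul0r mulr0.
rewrite mulrCA divff ?mulr1// expf_neq0 // -[0]/(0%:C) (inj_eq (@complexI R))//.
Qed.

(** Uniqueness of the linear coefficient: s = 0 gives A = 0, and division by s bounds |B| by a
    multiple of s. The bound on the remainder is a nonnegative complex number, hence real, and the
    estimate takes place in R. *)
Lemma taylor1_0 A B : taylor1 (fun=> 0) A B -> B = 0.
Proof.
move=> [r [c cb] rE].
have A0 : A = 0.
  have := rE 0; rewrite normr0 ler01 mul0r expr0n mul0r !addr0 => /(_ isT)->//.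
have c0 : 0 <= c by apply: (le_trans _ (cb 0 _)); rewrite ?normr0 ?ler01.
have cE : c = (complex.Re c)%:C.
  by apply/esym/RRe_real; exact: ger0_real.
rewrite cE in cb c0 *; move: (complex.Re c) c0 cb => b; rewrite ler0c => b0 cb {c cE}.
have BE (s : R) : 0 < s -> s <= 1 -> `|B| <= (b * s)%:C.
  move=> s0 s1.
  have n1 : `|s| <= 1 by rewrite ger0_norm// ltW.
  have := rE s n1.
  rewrite A0 add0r expr2 -mulrA -mulrDr => /esym/eqP; rewrite mulf_eq0.
  rewrite -[X in _ == X]/(0%:C) (inj_eq (@complexI R)) gt_eqF//= addr_eq0 => /eqP ->.
  rewrite normrN normrM rmorphM mulrC ler_pM//; first exact: cb.
  by rewrite normc_def /= expr0n addr0 sqrtr_sqr ger0_norm// ltW.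
have NE : `|B| = (complex.Re `|B|)%:C by apply/esym/RRe_real/normr_real.
apply/eqP; rewrite -normr_le0 NE lecR; apply/ler_addgt0Pr => e e0; rewrite add0r.
pose s := Num.min 1 (e / (b + 1)).
have s0 : 0 < s by rewrite lt_min ltr01 divr_gt0//; lra.
have := BE s s0; rewrite ge_min lexx => /(_ isT); rewrite NE lecR => /le_trans; apply.
have : s <= e / (b + 1) by rewrite ge_min lexx orbT.
rewrite ler_pdivlMr; last lra.
by rewrite mulrDr mulr1 mulrC; lra.
Qed.

(* The rational parametrization of the circle: s is the tangent of half the angle. *)
Definition cs (s : R) : R := (1 - s ^+ 2) / (1 + s ^+ 2).
Definition sn (s : R) : R := 2 * s / (1 + s ^+ 2).

Lemma cs_sn s : cs s ^+ 2 + sn s ^+ 2 = 1.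
Proof. rewrite /cs /sn; field; have := sqr_ge0 s; lra. Qed.

Lemma bounded1_inv : bounded1 (fun s => ((1 + s ^+ 2)^-1)%:C).
Proof.
exists 1 => s s1; have s2 := sqr_ge0 s.
rewrite normc_def /= expr0n addr0 sqrtr_sqr (_ : 1 = 1%:C :> R[i])// lecR ger0_norm ?invr_ge0; last lra.
by rewrite invf_le1; lra.
Qed.

Lemma taylor1_cs : taylor1 (fun s => (cs s)%:C) 1 0.
Proof.
exists (fun s => (- 2)%:C * ((1 + s ^+ 2)^-1)%:C).
  by apply: bounded1M; [exact: bounded1_cst|exact: bounded1_inv].
move=> s _; rewrite mulr0 addr0 -rmorphM -rmorphXn -rmorphM (_ : 1 = 1%:C :> R[i])// -rmorphD.
congr (_%:C); rewrite /cs; field; have := sqr_ge0 s; lra.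
Qed.

(** sn s = 2 s - 2 s^3 / (1 + s^2). The slope is 2 because the angle is twice the arctangent of s;
    this is the origin of the factors 2 in the expansions below. *)
Lemma taylor1_sn : taylor1 (fun s => (sn s)%:C) 0 2.
Proof.
exists (fun s => (- 2)%:C * s%:C * ((1 + s ^+ 2)^-1)%:C).
  apply: bounded1M; last exact: bounded1_inv.
  by apply: bounded1M; [exact: bounded1_cst|exact: bounded1_id].
move=> s _; rewrite add0r -rmorphM -rmorphXn -!rmorphM.
have -> : 2 = 2%:C :> R[i] by rewrite -[2](rmorph_nat (real_complex R)).
rewrite -!rmorphM -rmorphD.
congr (_%:C); rewrite /sn; field; have := sqr_ge0 s; lra.
Qed.

End FirstOrder.

(** There are finitely many sequences of indices of length at most N, so constants depending on the
    sequence can be replaced by one. The induction on N sums over the first index. *)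
Lemma bounded_seqs (R : realType) (d : nat) (P : seq 'I_d -> R -> Prop) :
  (forall s B C, B <= C -> P s B -> P s C) ->
  (forall s, exists2 B, 0 <= B & P s B) ->
  forall N, exists2 B, 0 <= B & forall s, (size s <= N)%N -> P s B.
Proof.
move=> + + N; elim: N P => [|N IH] P mon H.
  by have [B B0 HB] := H [::]; exists B => // -[].
have [B B0 HB] := H [::].
have {}IH i : exists2 C, 0 <= C & forall s, (size s <= N)%N -> P (i :: s) C.
  by apply: IH => [s C C'|s]; [exact: mon|exact: H].
pose C i := projT1 (cid2 (IH i)).
have C0 i : 0 <= C i by rewrite /C; case: cid2.
have HC i s : (size s <= N)%N -> P (i :: s) (C i) by rewrite /C; case: cid2 => x ? /=; apply.
exists (B + \sum_i C i); first by rewrite addr_ge0// sumr_ge0.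
case=> [_|i s sN]; first by apply: mon HB; rewrite lerDl sumr_ge0.
apply: mon (HC i s sN); rewrite (bigD1 i)//= addrCA lerDl addr_ge0// sumr_ge0//.
Qed.

(** * Functionals on real test functions and their Taylor estimate *)

Section Functional.
Variables (R : realType) (d : nat).
Local Notation V := 'rV[R]_d.
Local Notation E := (@E R d).
Implicit Types (u w : V -> R) (i j : 'I_d).

(** This is a distribution seen on real-valued test functions: linear over R with complex values. *)
Record real_functional (F : (V -> R) -> R[i]) : Prop := RealFunctional {
  functional_add : forall u w, Test u -> Test w -> F (fun x => u x + w x) = F u + F w;
  functional_scale : forall (c : R) u, Test u -> F (fun x => c * u x) = c%:C * F u }.

Definition functional_bounded (F : (V -> R) -> R[i]) :=
  forall A : R, exists (C : R) (N : nat), 0 <= C /\ forall u (M : R),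
    Test u -> vanish A u -> (forall s, (size s <= N)%N -> forall x, `|partials s u x| <= M) ->
    `|F u| <= (C * M)%:C.

Lemma functional_sub F u w : real_functional F -> Test u -> Test w ->
  F (fun x => u x - w x) = F u - F w.
Proof.
move=> [FD FZ] Hu Hw; have := FD _ _ Hu (Test_scale (-1) Hw).
rewrite FZ// rmorphN rmorph1 mulN1r => <-.
by congr F; apply/funext => x; rewrite mulN1r.
Qed.

Lemma functional_0 F : real_functional F -> F (fun=> 0) = 0.
Proof.
move=> HF; have := functional_sub HF (@Test_0 R d) (@Test_0 R d); by rewrite !subrr.
Qed.

Lemma Test_partials s u : Test u -> Test (partials s u).
Proof. by elim: s => //= i s IH /IH; exact: Test_D. Qed.

Lemma partials_D s i u : Test u -> partials s (D i u) = D i (partials s u).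
Proof.
move=> Hu; elim: s => //= j s ->.
by have := D_comm j i (Test_partials s Hu).
Qed.

Lemma partials_shift s u y : Test u ->
  partials s (fun x => u (x + y)) = fun x => partials s u (x + y).
Proof.
move=> Hu; elim: s => //= i s ->.
by have := D_shift i y (Test_partials s Hu).1.
Qed.

Lemma partials_sub s u w : Test u -> Test w ->
  partials s (fun x => u x - w x) = fun x => partials s u x - partials s w x.
Proof.
move=> Hu Hw; elim: s => //= i s ->.
by have := D_sub i (Test_partials s Hu).1 (Test_partials s Hw).1.
Qed.

Lemma partials_scale s (c : R) u : Test u ->
  partials s (fun x => c * u x) = fun x => c * partials s u x.
Proof.
move=> Hu; elim: s => //= i s ->.
by have := D_scale i c (Test_partials s Hu).1.
Qed.

(** The Taylor remainder of u is itself a test function, and its derivatives are the Taylor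
    remainders of the derivatives of u. They are uniformly quadratic, so the seminorm estimate
    applies. *)
Lemma functional_quad F u i j (L : R) : real_functional F -> functional_bounded F -> Test u ->
  exists2 C, 0 <= C & forall a b : R, `|a| <= L -> `|b| <= L ->
   `|F (fun x => u (x + (a *: E i + b *: E j))) - F u - a%:C * F (D i u) - b%:C * F (D j u)|
     <= (C * (a ^+ 2 + b ^+ 2))%:C.
Proof.
move=> HF Fb Hu; have [_ [A uA]] := Hu.
(* One ball for all remainders: 1 for the derivatives of u, 2 |L| for the shift, whose norm is at
   most |a| + |b|. *)
have [C [N [C0 HC]]] := Fb (A + 1 + 2 * `|L|).
pose P s B := forall x (a b : R),
  `|partials s u (x + a *: E i + b *: E j) - partials s u x - a * D i (partials s u) x
    - b * D j (partials s u) x| <= B * (a ^+ 2 + b ^+ 2).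
have [||B B0 HB] := @bounded_seqs R d P _ _ N.
- move=> s B B' BB' HB x a b; apply: le_trans (HB x a b) _.
  by rewrite ler_wpM2r// addr_ge0// sqr_ge0.
- by move=> s; exact: Test_quad2 (Test_partials s Hu).
exists (C * B); first by rewrite mulr_ge0.
move=> a b aL bL; set y := a *: E i + b *: E j.
have T1 := Test_shift y Hu; have T2 := Test_scale a (Test_D i Hu).
have T3 := Test_scale b (Test_D j Hu).
rewrite -!(functional_scale HF); try exact: Test_D.
rewrite -(functional_sub HF)// -(functional_sub HF)//; last exact: Test_sub.
rewrite -(functional_sub HF)//; last by apply: Test_sub => //; exact: Test_sub.
rewrite -mulrA; apply: HC.
- by apply: Test_sub => //; apply: Test_sub => //; exact: Test_sub.
- move=> x Ax; have L0 := normr_ge0 L; have LL := ler_norm L.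
  have y2 : `|y| <= 2 * `|L|.
    apply: (le_trans (ler_normD _ _)); rewrite !normrZ.
    have := norm_E R i; have := norm_E R j; have := normr_ge0 a; have := normr_ge0 b.
    by have := normr_ge0 (E i); have := normr_ge0 (E j); nra.
  have xy : `|x| <= `|x + y| + `|y| by rewrite -{1}(addrK y x); exact: ler_normB.
  rewrite uA; last by lra.
  rewrite (uA x); last by lra.
  by rewrite !(vanish_D _ uA) ?mulr0 ?subr0//; lra.
- move=> s sN x.
  rewrite partials_sub//; last by apply: Test_sub => //; exact: Test_sub.
  rewrite partials_sub//; last exact: Test_sub.
  rewrite partials_sub// partials_shift// !partials_scale; try exact: Test_D.
  by rewrite !partials_D// /y addrA; exact: HB.
Qed.

End Functional.

(** * Expansion of the pairing when the point turns on the circle *)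

Section Circle.
Variables (R : realType) (d : nat).
Local Notation V := 'rV[R]_d.
Local Notation E := (@E R d).
Implicit Types (u w : V -> R).
Variables (F : (V -> R) -> R[i]) (i j : 'I_d).
Hypotheses (HF : real_functional F) (Fb : functional_bounded F).

(* Derivative along the tangent vector (-b, a) at the point (a, b) of the circle *)
Definition tangentD (a b : R) u : V -> R := fun x => a * D j u x - b * D i u x.
Definition radialD (a b : R) u : V -> R := fun x => a * D i u x + b * D j u x.
(* Translation by k (a, b) in the distributional sense, hence the sign *)
Definition moved (k : nat) (a b : R) u : V -> R :=
  fun x => u (x + ((- (k%:R * a)) *: E i + (- (k%:R * b)) *: E j)).

Lemma Test_tangentD a b u : Test u -> Test (tangentD a b u).
Proof. by move=> Hu; apply: Test_sub; apply: Test_scale; exact: Test_D. Qed.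

Lemma Test_radialD a b u : Test u -> Test (radialD a b u).
Proof. by move=> Hu; apply: Test_add; apply: Test_scale; exact: Test_D. Qed.

Lemma Test_iter_tangentD n a b u : Test u -> Test (iter n (tangentD a b) u).
Proof. by move=> Hu; elim: n => //= n; exact: Test_tangentD. Qed.

Lemma Test_moved k a b u : Test u -> Test (moved k a b u).
Proof. exact: Test_shift. Qed.

Lemma D_linB l u w (p q : R) : Test u -> Test w ->
  D l (fun x => p * u x - q * w x) = fun x => p * D l u x - q * D l w x.
Proof.
move=> Hu Hw; rewrite (D_sub l (Test_scale p Hu).1 (Test_scale q Hw).1).
by rewrite (D_scale l p Hu.1) (D_scale l q Hw.1).
Qed.

Lemma D_linD l u w (p q : R) : Test u -> Test w ->
  D l (fun x => p * u x + q * w x) = fun x => p * D l u x + q * D l w x.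
Proof.
move=> Hu Hw; rewrite (D_add l (Test_scale p Hu).1 (Test_scale q Hw).1).
by rewrite (D_scale l p Hu.1) (D_scale l q Hw.1).
Qed.

Lemma tangentD_sub a b u w (p q : R) : Test u -> Test w ->
  tangentD a b (fun x => p * u x - q * w x) =
  fun x => p * tangentD a b u x - q * tangentD a b w x.
Proof.
move=> Hu Hw; apply/funext => x; rewrite /tangentD (D_linB i)// (D_linB j)//.
by move: (D i u x) (D j u x) (D i w x) (D j w x) => *; ring.
Qed.

Lemma iter_tangentD_sub n a b u w (p q : R) : Test u -> Test w ->
  iter n (tangentD a b) (fun x => p * u x - q * w x) =
  fun x => p * iter n (tangentD a b) u x - q * iter n (tangentD a b) w x.
Proof.
move=> Hu Hw; elim: n => //= n ->.
by rewrite tangentD_sub//; exact: Test_iter_tangentD.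
Qed.

Lemma tangentD_radialD a b u : Test u ->
  tangentD a b (radialD a b u) = radialD a b (tangentD a b u).
Proof.
move=> Hu; have Hi := Test_D i Hu; have Hj := Test_D j Hu.
apply/funext => x; rewrite /tangentD /radialD (D_linD i)// (D_linD j)//.
rewrite (D_linB i)// (D_linB j)// (D_comm i j)//.
by move: (D i (D i u) x) (D j (D i u) x) (D j (D j u) x) => *; ring.
Qed.

Lemma moved_D k a b l u : Test u -> D l (moved k a b u) = moved k a b (D l u).
Proof. by move=> Hu; exact: (D_shift _ _ Hu.1). Qed.

Variables (a0 b0 : R).
Let al s := cs s * a0 - sn s * b0.
Let be s := cs s * b0 + sn s * a0.
Local Notation X := (tangentD a0 b0).
Local Notation Y := (radialD a0 b0).
Local Notation M k := (moved k a0 b0).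

(** The tangent direction turns together with the point; this is where radial derivatives enter. *)
Lemma tangentD_rotate s u : Test u ->
  tangentD (al s) (be s) u = fun x => cs s * X u x - sn s * Y u x.
Proof. by move=> Hu; apply/funext => x; rewrite /tangentD /radialD /al /be;
  move: (D i u x) (D j u x) (cs s) (sn s) => *; ring. Qed.

Lemma sn_bound (s : R) : `|sn s| <= 2 * `|s|.
Proof.
have s2 := sqr_ge0 s; have p : 0 < 1 + s ^+ 2 by lra.
rewrite /sn !normrM normfV (gtr0_norm p) ler_pdivrMr// (ger0_norm (ler0n R 2)).
by have := mulr_ge0 (normr_ge0 s) s2; lra.
Qed.

Lemma cs_bound (s : R) : `|s| <= 1 -> `|cs s - 1| <= 2 * `|s|.
Proof.
move=> s1; have s2 := sqr_ge0 s.
have -> : cs s - 1 = - (2 * s ^+ 2 / (1 + s ^+ 2)) by rewrite /cs; field; lra.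
have p : 0 < 1 + s ^+ 2 by lra.
rewrite normrN !normrM normfV (gtr0_norm p) ler_pdivrMr// (ger0_norm (ler0n R 2)).
have := mulr_ge0 (normr_ge0 s) s2; have : `|s| * `|s| <= `|s| by rewrite ler_piMl.
lra.
Qed.

(** The point (a0, b0) leaves with velocity 2 (-b0, a0), so the translate by its -k-fold has
    derivative -2 k times the tangential derivative. The increments are O(s), and [functional_quad]
    makes the error O(s^2). *)
Lemma taylor1_moved k u : Test u ->
  taylor1 (fun s => F (moved k (al s) (be s) u))
    (F (M k u)) (- (2 * k%:R) * F (M k (X u))).
Proof.
move=> Hu; have Hv := Test_moved k a0 b0 Hu; set v := M k u in Hv *.
pose a s := - (k%:R * (al s - a0)); pose b s := - (k%:R * (be s - b0)).
have vE s : moved k (al s) (be s) u = fun x => v (x + (a s *: E i + b s *: E j)).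
  apply/funext => x; rewrite /v /moved -addrA addrACA -!scalerDl.
  by congr (u (_ + (_ *: _ + _ *: _))); rewrite /a /b; ring.
pose L := k%:R * (2 * (`|a0| + `|b0|)).
have L0 : 0 <= L by rewrite !mulr_ge0 ?addr_ge0.
have aL s : `|s| <= 1 -> `|a s| <= L * `|s|.
  move=> s1; rewrite /a normrN normrM ger0_norm// -mulrA ler_wpM2l//.
  have -> : al s - a0 = (cs s - 1) * a0 - sn s * b0 by rewrite /al; ring.
  apply: (le_trans (ler_normB _ _)); rewrite (normrM _ a0) (normrM _ b0).
  have := ler_wpM2r (normr_ge0 b0) (sn_bound s).
  have := ler_wpM2r (normr_ge0 a0) (cs_bound s1); lra.
have bL s : `|s| <= 1 -> `|b s| <= L * `|s|.
  move=> s1; rewrite /b normrN normrM ger0_norm// -mulrA ler_wpM2l//.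
  have -> : be s - b0 = (cs s - 1) * b0 + sn s * a0 by rewrite /be; ring.
  apply: (le_trans (ler_normD _ _)); rewrite (normrM _ a0) (normrM _ b0).
  have := ler_wpM2r (normr_ge0 a0) (sn_bound s).
  have := ler_wpM2r (normr_ge0 b0) (cs_bound s1); lra.
clearbody L; have [C C0 HC] := functional_quad i j L HF Fb Hv.
have aT : taylor1 (fun s => (a s)%:C) 0 (2 * k%:R * b0%:C).
  have := taylor1Z (- k%:R) (taylor1D (taylor1D (taylor1Z a0%:C (taylor1_cs R))
    (taylor1Z (- b0%:C) (taylor1_sn R))) (taylor1_cst (- a0%:C))).
  have -> : (fun s => - k%:R * (a0%:C * (cs s)%:C + - b0%:C * (sn s)%:C + - a0%:C)) =
      fun s => (a s)%:C.
    apply/funext => s; rewrite /a /al !(rmorphN, rmorphM, rmorphB, rmorph_nat).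
    ring.
  by move/taylor1_eq; apply; ring.
have bT : taylor1 (fun s => (b s)%:C) 0 (- (2 * k%:R * a0%:C)).
  have := taylor1Z (- k%:R) (taylor1D (taylor1D (taylor1Z b0%:C (taylor1_cs R))
    (taylor1Z (a0%:C) (taylor1_sn R))) (taylor1_cst (- b0%:C))).
  have -> : (fun s => - k%:R * (b0%:C * (cs s)%:C + a0%:C * (sn s)%:C + - b0%:C)) =
      fun s => (b s)%:C.
    apply/funext => s; rewrite /b /be !(rmorphN, rmorphM, rmorphB, rmorphD, rmorph_nat).
    ring.
  by move/taylor1_eq; apply; ring.
(* K is the error after subtracting the linear terms in the increments; these are then put back
   through their own expansions [aT] and [bT]. *)
pose K s := F (moved k (al s) (be s) u) - F v - (a s)%:C * F (D i v) - (b s)%:C * F (D j v).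
have KT : taylor1 K 0 0.
  apply: (@taylor1_bound _ _ (C * (2 * L ^+ 2))) => s s1.
  have sL : L * `|s| <= L by rewrite -[leRHS]mulr1 ler_wpM2l.
  rewrite /K vE; apply: (le_trans (HC _ _ _ _)).
  - exact: le_trans (aL s s1) sL.
  - exact: le_trans (bL s s1) sL.
  rewrite lecR -[leRHS]mulrA ler_wpM2l// -[a s ^+ 2]real_normK ?num_real//.
  rewrite -[b s ^+ 2]real_normK ?num_real// -[s ^+ 2]real_normK ?num_real//.
  have := aL s s1; have := bL s s1; have := normr_ge0 (a s); have := normr_ge0 (b s).
  move: `|a s| `|b s| => p q q0 p0 qs ps.
  have : p ^+ 2 <= (L * `|s|) ^+ 2 by rewrite ler_sqr ?nnegrE// (le_trans p0).
  have : q ^+ 2 <= (L * `|s|) ^+ 2 by rewrite ler_sqr ?nnegrE// (le_trans q0).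
  by rewrite exprMn; lra.
have := taylor1D (taylor1D KT (taylor1_cst (F v)))
  (taylor1D (taylor1Z (F (D i v)) aT) (taylor1Z (F (D j v)) bT)).
have -> : (fun s => K s + F v + (F (D i v) * (a s)%:C + F (D j v) * (b s)%:C)) =
  fun s => F (moved k (al s) (be s) u).
  by apply/funext => s; rewrite /K; move: (F _) (F _) (F _) (F _) _%:C _%:C => *; ring.
move/taylor1_eq; apply; first by rewrite !mulr0 !addr0 add0r.
rewrite /v !moved_D//.
have Ti := Test_moved k a0 b0 (Test_D i Hu); have Tj := Test_moved k a0 b0 (Test_D j Hu).
have -> : M k (X u) = fun x => a0 * M k (D j u) x - b0 * M k (D i u) x by [].
rewrite (functional_sub HF); try exact: Test_scale.
rewrite !(functional_scale HF)//.
by move: (F _) (F _) a0%:C b0%:C => p q x y; ring.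
Qed.

(** A product rule: the motion of the point contributes -2 k X^(n+1), and the turning of each of the
    n tangential derivatives contributes -2 X^(n-1) Y. The induction replaces one rotated derivative
    by cs X - sn Y. For n = 0 the truncated predecessor stands behind the coefficient 0. *)
Lemma taylor1_moved_tangentD n k u : Test u ->
  taylor1 (fun s => F (moved k (al s) (be s) (iter n (tangentD (al s) (be s)) u)))
    (F (M k (iter n X u)))
    (- (2 * k%:R) * F (M k (iter n.+1 X u)) - 2 * n%:R * F (M k (iter n.-1 X (Y u)))).
Proof.
elim: n u => [|n IH] u Hu.
  by apply: (taylor1_eq (taylor1_moved k Hu)) => //; rewrite mulr0 mul0r subr0.
have HX := Test_tangentD a0 b0 Hu; have HY := Test_radialD a0 b0 Hu.
have := taylor1D (taylor1M (taylor1_cs R) (IH _ HX))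
  (taylor1Z (-1) (taylor1M (taylor1_sn R) (IH _ HY))).
have -> : (fun s : R => (cs s)%:C * F (moved k (al s) (be s) (iter n (tangentD (al s) (be s)) (X u)))
   + -1 * ((sn s)%:C * F (moved k (al s) (be s) (iter n (tangentD (al s) (be s)) (Y u))))) =
   fun s => F (moved k (al s) (be s) (iter n.+1 (tangentD (al s) (be s)) u)).
  apply/funext => s; rewrite iterSr tangentD_rotate// iter_tangentD_sub//.
  have T1 := Test_moved k (al s) (be s) (Test_iter_tangentD n (al s) (be s) HX).
  have T2 := Test_moved k (al s) (be s) (Test_iter_tangentD n (al s) (be s) HY).
  rewrite [RHS](functional_sub HF (Test_scale (cs s) T1) (Test_scale (sn s) T2)).
  by rewrite !(functional_scale HF)// mulN1r.
move/taylor1_eq; apply.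
  by rewrite iterSr mul1r mul0r mulr0 addr0.
(* For n = 0 the terms q and r differ, but q carries the factor n; for n > 0 they agree because X
   and Y commute. *)
have comb (K p q a b r : R[i]) : (n = 0%N \/ q = r) ->
    1 * (- (2 * K) * p - 2 * n%:R * q) + 0 * a + -1 * (0 * b + 2 * r) =
    - (2 * K) * p - 2 * n.+1%:R * r.
  by rewrite -[n.+1%:R]natr1 => -[->|->]; ring.
have -> : iter n.+2 X u = iter n.+1 X (X u) by rewrite iterSr.
apply: comb; case: n {IH} => [|n]; first by left.
by right; rewrite -tangentD_radialD// iterSr.
Qed.

End Circle.

(** * Raising the order of the relation and isolating its leading term *)

Section Annihilator.
Variables (R : realType) (d : nat).
Local Notation V := 'rV[R]_d.
Variables (F : (V -> R) -> R[i]) (i j : 'I_d) (delta : R) (n : nat).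
Hypotheses (HF : real_functional F) (Fb : functional_bounded F).
Implicit Types (h : nat -> R[i]) (u : V -> R).

(** [h] lists the coefficients of a polynomial in the translation, so z d/dz is multiplication of
    [h k] by [k]. The relation is required on the whole circle in order to be differentiable along
    it. *)
Definition annihilates N h := forall (a b : R) u, a ^+ 2 + b ^+ 2 = delta ^+ 2 -> Test u ->
  \sum_(k < n) h k * F (moved i j k a b (iter N (tangentD i j a b) u)) = 0.

Lemma annihilatesW N h : annihilates N h -> annihilates N.+1 h.
Proof.
move=> H a b u ab Hu; have := H a b _ ab (Test_tangentD i j a b Hu).
by under eq_bigr do rewrite -iterSr.
Qed.

(* First-order expansion, at a point of the circle, of the relation applied to the tangential
   derivative of u: the term with radialD vanishes by the relation itself. *)
Lemma annihilates_theta N h : annihilates N h -> annihilates N.+2 (fun k => k%:R * h k).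
Proof.
move=> H a b u ab Hu; have HX := Test_tangentD i j a b Hu.
have HY := Test_radialD i j a b Hu.
have T k := taylor1Z (h k) (taylor1_moved_tangentD i j HF Fb a b N k HX).
have := taylor1_sum n T.
have -> : (fun s => \sum_(k < n) h k * F (moved i j k (cs s * a - sn s * b)
    (cs s * b + sn s * a) (iter N (tangentD i j (cs s * a - sn s * b) (cs s * b + sn s * a))
    (tangentD i j a b u)))) = fun=> 0.
  apply/funext => s; apply: H => //; rewrite -ab -[RHS]mul1r -(cs_sn s); ring.
move=> /taylor1_0; under eq_bigr do rewrite mulrBr; rewrite sumrB.
have -> : \sum_(k < n) h k * (2 * N%:R * F (moved i j k a b
    (iter N.-1 (tangentD i j a b) (radialD i j a b (tangentD i j a b u))))) = 0.
  case: N H {T} => [|m] H; first by rewrite big1// => k _; rewrite mulr0 mul0r mulr0.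
  transitivity (2 * m.+1%:R * \sum_(k < n) h k * F (moved i j k a b
      (iter m.+1 (tangentD i j a b) (radialD i j a b u)))); last by rewrite H ?mulr0.
  rewrite mulr_sumr; apply: eq_bigr => k _; rewrite mulrCA /=.
  by rewrite -tangentD_radialD// -iterSr.
rewrite subr0 => E.
apply/eqP; have := E.
under eq_bigr => k _ do
  rewrite -iterSr mulrA mulrN mulrCA [h k * _]mulrC -mulNr -mulrA.
by rewrite -mulr_sumr => /eqP; rewrite mulf_eq0 oppr_eq0 pnatr_eq0.
Qed.

(** The original relation survives two further tangential derivatives, so c times it can be
    subtracted at order N + 2. *)
Lemma annihilates_theta_sub N h c : annihilates N h ->
  annihilates N.+2 (fun k => (k%:R - c) * h k).
Proof.
move=> H a b u ab Hu.
have := annihilates_theta H ab Hu; have := annihilatesW (annihilatesW H) ab Hu.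
pose G k := F (moved i j k a b (iter N.+2 (tangentD i j a b) u)) => E0 E1.
transitivity (\sum_(k < n) k%:R * h k * G k - c * \sum_(k < n) h k * G k).
  by rewrite mulr_sumr -sumrB; apply: eq_bigr => k _; rewrite !mulrBl -(mulrA c).
by rewrite [X in _ * X]E0 [X in X - _]E1 mulr0 subr0.
Qed.

(** The new coefficient is k (k - 1) ... (k - l + 1) h_k, that is, the polynomial becomes z^l times
    its l-th derivative. *)
Lemma annihilates_falling h l : annihilates 0 h ->
  annihilates l.*2 (fun k => (\prod_(m < l) (k%:R - m%:R)) * h k).
Proof.
move=> H; elim: l => [|l IH].
  by move=> a b u ab Hu; under eq_bigr do rewrite big_ord0 mul1r; exact: H.
rewrite doubleS => a b u ab Hu.
rewrite -[RHS](annihilates_theta_sub l%:R IH ab Hu); apply: eq_bigr => k _.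
by rewrite big_ord_recr /= [X in X * _ * _ = _]mulrC !mulrA.
Qed.

End Annihilator.

(** With l = m only k = m survives, with the nonzero coefficient m! h_m; at the point (delta, 0) the
    tangential derivative is delta D_j. *)
Lemma functional_kills_partials (R : realType) (d : nat) (F : ('rV[R]_d -> R) -> R[i])
    (i j : 'I_d) (delta : R) (m : nat) (h : nat -> R[i]) :
  real_functional F -> functional_bounded F -> delta != 0 -> h m != 0 ->
  annihilates F i j delta m.+1 0 h ->
  forall u, Test u -> F (iter m.*2 (D j) u) = 0.
Proof.
move=> HF Fb d0 hm H u Hu.
(* The shift performed by [moved] for k = m at (delta, 0); applying the relation to u shifted by -y
   cancels it. *)
pose y := (- (m%:R * delta)) *: E R i + (- (m%:R * 0)) *: E R j.
have Hv := Test_shift (- y) Hu.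
have E0 : delta ^+ 2 + 0 ^+ 2 = delta ^+ 2 by rewrite expr0n addr0.
have := annihilates_falling HF Fb m H E0 Hv.
(* For k < m the product contains the factor k - k. *)
rewrite big_ord_recr /= big1 ?add0r => [|k _]; last first.
  by rewrite (bigD1 (Ordinal (ltn_ord k)))//= subrr !mul0r.
move/eqP; rewrite mulf_eq0 mulf_eq0 (negPf hm) orbF prodf_seq_eq0 => /orP[/hasP[k _] /=|].
  by rewrite subr_eq0 eqr_nat eq_sym ltn_eqF.
have itE l w : Test w -> iter l (tangentD i j delta 0) w = fun x => delta ^+ l * iter l (D j) w x.
  move=> Hw; have Tl k : Test (iter k (D j) w) by elim: k => //= k; exact: Test_D.
  elim: l => [|l IH] /=; first by apply/funext => x; rewrite expr0 mul1r.
  rewrite IH; apply/funext => x; rewrite /tangentD mul0r subr0.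
  by rewrite (D_scale j (delta ^+ l) (Tl l).1) exprS mulrA.
rewrite itE// /moved.
have sh l w z : Test w -> iter l (D j) (fun x => w (x + z)) = fun x => iter l (D j) w (x + z).
  move=> Hw; have Tl k : Test (iter k (D j) w) by elim: k => //= k; exact: Test_D.
  by elim: l => //= l ->; rewrite (D_shift j z (Tl l).1).
rewrite sh//; under eq_fun do rewrite -/y addrK.
have Tl : Test (iter m.*2 (D j) u) by elim: m.*2 => //= k; exact: Test_D.
rewrite (functional_scale HF)// => /eqP/eqP; rewrite mulf_eq0 => /orP[|/eqP//].
by rewrite -[X in _ == X]/(0%:C) (inj_eq (@complexI R)) expf_eq0 (negPf d0) andbF.
Qed.

(** * Integration along a coordinate *)

Section Integral1.
Variable R : realType.
Local Notation mu := (@lebesgue_measure R).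
Implicit Types (g h : R -> R) (D : set (measurableTypeR R)).

Definition vanish1 (A : R) h := forall t, A < `|t| -> h t = 0.

Lemma vanish1_itv A h : vanish1 A h -> h = h \_ `[- A, A].
Proof.
move=> Ah; apply/funext => t; rewrite patchE; case: ifPn => // tA.
apply: Ah; rewrite ltNge; apply: contra tA => tA.
by rewrite inE /= in_itv /= -ler_norml.
Qed.

Lemma cc_integrable D A h : measurable D -> continuous h -> vanish1 A h ->
  mu.-integrable D (EFin \o h).
Proof.
move=> mD hc Ah; apply: (@integrableS _ _ _ mu setT) => //.
rewrite (vanish1_itv Ah) -restrict_EFin; apply: (iffLR (integrable_mkcond _ _)) => //.
apply: continuous_compact_integrable; first exact: segment_compact.
exact: continuous_subspaceT.
Qed.

Lemma RintegralI D A h : vanish1 A h ->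
  \int[mu]_(t in D) h t = \int[mu]_(t in D `&` `[- A, A]) h t.
Proof. by move=> Ah; rewrite Rintegral_mkcondr -vanish1_itv. Qed.

Lemma Rintegral_le_sup D (A : R) h (M : R) : 0 <= A -> measurable D -> continuous h -> vanish1 A h ->
  (forall t, `|h t| <= M) -> `|\int[mu]_(t in D) h t| <= 2 * A * M.
Proof.
move=> A0 mD hc Ah hM; rewrite (RintegralI _ Ah).
have M0 : 0 <= M := le_trans (normr_ge0 _) (hM 0).
have mI : measurable (D `&` `[- A, A] : set (measurableTypeR R)) by apply: measurableI.
apply: (le_trans (le_normr_Rintegral mI (cc_integrable mI hc Ah))).
have muA : mu `[- A, A] = (2 * A)%:E.
  rewrite lebesgue_measure_itv /= lte_fin; case: ltP => AA.
    by rewrite -EFinB; congr (_%:E); ring.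
  by congr (_%:E); lra.
have muD : (mu (D `&` `[(- A)%R, A]) <= (2 * A)%:E)%E.
  by rewrite -muA; apply: le_measure; rewrite ?inE//; exact: subIsetr.
apply: (@le_trans _ _ (\int[mu]_(t in D `&` `[- A, A]) M)).
  apply: le_Rintegral => //.
  - apply: (@cc_integrable _ A (fun t => `|h t|)) => //.
      by move=> t; apply: continuous_comp; [exact: hc|exact: norm_continuous].
    by move=> t tA; rewrite Ah// normr0.
  - apply: (@measurable_bounded_integrable _ _ _ mu (cst M)) => //; last exact: bounded_cst.
    by rewrite (le_lt_trans muD)// ltry.
rewrite Rintegral_cst// mulrC ler_wpM2r//.
rewrite -lee_fin fineK// ge0_fin_numE//.
by rewrite (le_lt_trans muD)// ltry.
Qed.

(** The condition on D covers at once the whole line, with c = A, and a half-line ending at c. *)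
Lemma Rintegral_FTC D A (c : R) g dg : 0 < A -> - A < c -> D `&` `[- A, A] = `[- A, c] ->
  (forall t : R, is_derive t 1 g (dg t)) -> continuous dg -> vanish1 A dg -> g (- A) = 0 ->
  \int[mu]_(t in D) dg t = g c.
Proof.
move=> A0 Ac DA dgE dgc dgA gA.
rewrite (RintegralI _ dgA) DA /Rintegral.
have gc : continuous g.
  by move=> t; apply/differentiable_continuous/derivable1_diffP; case: (dgE t).
rewrite (@continuous_FTC2 _ dg g)//.
- by rewrite gA sube0.
- exact: continuous_subspaceT.
- split; first by move=> t _; case: (dgE t).
  + exact/cvg_at_right_filter/gc.
  + exact/cvg_at_left_filter/gc.
- by move=> t _; rewrite derive1E; case: (dgE t).
Qed.

End Integral1.

Section Param.
Variables (R : realType) (d : nat).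
Local Notation V := 'rV[R]_d.
Local Notation mu := (@lebesgue_measure R).
Local Notation E := (@E R d).
Implicit Types (h u w : V -> R) (x y : V) (i l : 'I_d) (G : set (measurableTypeR R)).

Lemma near_dist x (e : R) : 0 < e -> \forall y \near x, `|x - y| < e.
Proof. by move=> e0; apply/nbhs_normP; exists e. Qed.

Lemma cc_unif h (A : R) : continuous h -> vanish A h -> forall e, 0 < e ->
  exists2 r, 0 < r & forall x y, `|x - y| < r -> `|h x - h y| <= e.
Proof.
move=> hc Ah e e0.
pose P (r : R) x := forall y, `|x - y| < r -> `|h x - h y| <= e.
have := @compact_ball0 R d (A + 1); rewrite compact_near_coveringP.
move=> /(_ R (0 : R)^'+ P _)[x _|r0 /= r00 Hr].
  have e2 : 0 < e / 2 by rewrite divr_gt0.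
  have /cvgrPdist_le /(_ _ e2) /nbhs_normP[r /= r0 Hr] := hc x.
  have Hr' y : `|x - y| < r -> `|h x - h y| <= e / 2 by apply: Hr.
  near=> x' s => y ys.
  have xx' : `|x - x'| < r / 2.
    by near: x'; apply: near_dist; rewrite divr_gt0.
  have sr : s < r / 2 by near: s; apply: nbhs_right_lt; rewrite divr_gt0.
  have h1 : `|h x - h x'| <= e / 2 by apply: Hr'; lra.
  have h2 : `|h x - h y| <= e / 2.
    apply: Hr'; rewrite -(subrKA x'); apply: le_lt_trans (ler_normD _ _) _.
    rewrite [ltRHS]splitr ltrD//; exact: lt_trans ys sr.
  have -> : h x' - h y = (h x - h y) - (h x - h x') by ring.
  by apply: le_trans (ler_normB _ _) _; lra.
(* The bound 1 keeps y off the ball of radius A when x is off that of radius A + 1; halving r0 gives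
   a strict inequality. *)
pose r := Num.min (r0 / 2) 1.
have rr0 : r < r0 by rewrite gt_min; apply/orP; left; lra.
have rp : 0 < r by rewrite lt_min ltr01 divr_gt0.
have r1 : r <= 1 by rewrite ge_min lexx orbT.
exists r => // x y xy; have [xA|xA] := leP `|x| (A + 1).
  apply: (Hr r _ _ x xA) => //=.
  by rewrite sub0r normrN gtr0_norm.
have : `|x| <= `|x - y| + `|y| by rewrite -{1}(subrK y x); exact: ler_normD.
move=> xy'; rewrite !Ah ?subrr ?normr0 ?ltW//; lra.
Unshelve. all: by end_near. Qed.

(* Unlike the integral over the i-th coordinate itself, this commutes with all the partial
   derivatives, including the i-th. *)
Definition line_integral i G w x := \int[mu]_(t in G) w (x + t *: E i).

Lemma line_cont h i x : continuous h -> continuous (fun t : R => h (x + t *: E i)).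
Proof.
move=> hc t; apply: (@continuous_comp _ _ _ (fun t : R => x + t *: E i) h); last exact: hc.
by apply: continuousD; [exact: cst_continuous|exact: scalel_continuous].
Qed.

Lemma norm_line x i (t : R) : `|t| <= `|x + t *: E i| + `|x|.
Proof.
have := coord_le_norm (x + t *: E i) i; rewrite !mxE !eqxx /= mulr1 => H.
rewrite -{1}(addrK (x ord0 i) t) [t + _]addrC.
by apply: le_trans (ler_normB _ _) _; apply: lerD => //; exact: coord_le_norm.
Qed.

Lemma line_vanish h (A : R) i x : vanish A h -> vanish1 (A + `|x|) (fun t => h (x + t *: E i)).
Proof. by move=> Ah t tA; apply: Ah; have := norm_line x i t; lra. Qed.

Lemma line_integrable h (A : R) i x G : measurable G -> continuous h -> vanish A h ->
  mu.-integrable G (EFin \o (fun t => h (x + t *: E i))).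
Proof.
move=> mD hc Ah; apply: cc_integrable => //; first exact: line_cont.
exact: line_vanish Ah.
Qed.

Lemma vanish_ge0 h (A : R) : vanish A h -> vanish `|A| h.
Proof. by apply: vanishW; exact: ler_norm. Qed.

Lemma line_integral_add h u (A B : R) i G : measurable G -> continuous h -> vanish A h ->
  continuous u -> vanish B u -> line_integral i G (fun x => h x + u x) =
  fun x => line_integral i G h x + line_integral i G u x.
Proof.
move=> mD hc hA uc uB; apply/funext => x; rewrite /line_integral RintegralD//.
- exact: line_integrable hA.
- exact: line_integrable uB.
Qed.

Lemma line_integral_scale h c (A : R) i G : measurable G -> continuous h -> vanish A h ->
  line_integral i G (fun x => c * h x) = fun x => c * line_integral i G h x.
Proof.
move=> mD hc hA; apply/funext => x; rewrite /line_integral RintegralZl//.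
exact: line_integrable hA.
Qed.

Lemma line_integral_cont h (A : R) i G : measurable G -> continuous h -> vanish A h ->
  continuous (line_integral i G h).
Proof.
move=> mD hc /vanish_ge0 hA.
suff H (x : V) (e : R) : 0 < e -> exists2 r : R, 0 < r &
    forall y : V, `|x - y| < r -> `|line_integral i G h x - line_integral i G h y| <= e.
  move=> x; apply/(@cvgrPdist_le _ _ _ _ (nbhs_filter x)) => e e0.
  have [r r0 Hr] := H x e e0.
  by apply: (@filterS _ _ (nbhs_filter x) _ _ _ (near_dist x r0)) => y; exact: Hr.
move=> e0.
have N0 := normr_ge0 x; have A0 := normr_ge0 A.
(* Length of an interval of t outside which the integrands at x and at every y within distance 1 of
   x vanish. *)
pose k := 2 * (`|A| + `|x| + 1).
have k0 : 0 < k by rewrite /k; lra.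
have [r r0 Hr] := cc_unif hc hA (divr_gt0 e0 k0).
exists (Num.min 1 r); first by rewrite lt_min ltr01.
move=> y; rewrite lt_min => /andP[xy1 xyr].
have -> : line_integral i G h x - line_integral i G h y =
    \int[mu]_(t in G) (h (x + t *: E i) - h (y + t *: E i)).
  by rewrite RintegralB//; exact: line_integrable hA.
apply: (@le_trans _ _ (k * (e / k))); last by rewrite mulrC divfK// gt_eqF.
have AA : 0 <= `|A| + `|x| + 1 by lra.
apply: Rintegral_le_sup => //.
- by apply: sub_cont; exact: line_cont.
- move=> t tA; have yx : `|y| <= `|x| + 1.
    by rewrite -[y](subKr x); apply: le_trans (ler_normB _ _) _; rewrite lerD2l ltW.
  by rewrite !(line_vanish i hA) ?subrr//; lra.
- move=> t; apply: Hr.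
  suff -> : x + t *: E i - (y + t *: E i) = x - y by [].
  by rewrite opprD addrACA subrr addr0.
Qed.

(** Differentiation under the integral sign: the quadratic remainder of h is uniform and lives on a
    bounded interval of t, so its integral is again quadratic and [is_derive_quad] applies. *)
Lemma line_integral_derive h i l G x : measurable G -> Test h ->
  is_derive x (E l) (line_integral i G h) (line_integral i G (D l h) x).
Proof.
move=> mD Hh; have [B B0 HB] := Test_quad l Hh.
have [_ [A /vanish_ge0 hA]] := Hh; have hc := Cinf_cont Hh.1.
have dc := Cinf_cont (smoothC_D l Hh.1); have dA := vanish_D l hA.
have N0 := normr_ge0 x; have A0 := normr_ge0 A.
apply: derive_line.
apply: (@is_derive_quad R _ _ (2 * (`|A| + `|x| + 1) * B)) => s s1.
rewrite scale0r addr0.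
have I y : mu.-integrable G (EFin \o (fun t => h (y + t *: E i))) by exact: line_integrable hA.
have -> : line_integral i G h (x + s *: E l) - line_integral i G h x - s * line_integral i G (D l h) x =
   \int[mu]_(t in G) (h (x + s *: E l + t *: E i) - h (x + t *: E i) - s * D l h (x + t *: E i)).
  have ID : mu.-integrable G (EFin \o (fun t => D l h (x + t *: E i))).
    exact: line_integrable dA.
  have IsD : mu.-integrable G (EFin \o (fun t => s * D l h (x + t *: E i))).
    apply: (@cc_integrable _ _ (`|A| + 1 + `|x|)) => //.
      by apply: scale_cont; exact: line_cont.
    by move=> t tA; rewrite (line_vanish i dA) ?mulr0.
  have IB : mu.-integrable G (EFin \o (fun t => h (x + s *: E l + t *: E i) - h (x + t *: E i))).
    apply: (@cc_integrable _ _ (`|A| + `|x| + 1)) => //.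
      by apply: sub_cont; exact: line_cont.
    move=> t tA; have yx : `|x + s *: E l| <= `|x| + 1.
      apply: le_trans (ler_normD _ _) _; rewrite lerD2l normrZ -[leRHS]mulr1.
      by rewrite ler_pM// norm_E.
    by rewrite !(line_vanish i hA) ?subrr//; lra.
  by rewrite (RintegralB _ IB IsD)// (RintegralB _ (I (x + s *: E l)) (I x))// RintegralZl.
rewrite -[leRHS]mulrA.
have AA : 0 <= `|A| + `|x| + 1 by lra.
apply: Rintegral_le_sup => //.
- by apply: sub_cont; [apply: sub_cont|apply: scale_cont]; exact: line_cont.
- move=> t tA; have yx : `|x + s *: E l| <= `|x| + 1.
    apply: le_trans (ler_normD _ _) _; rewrite lerD2l normrZ -[leRHS]mulr1.
    by rewrite ler_pM// norm_E.
  rewrite !(line_vanish i hA) ?(line_vanish i dA) ?mulr0 ?subrr//; lra.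
- by move=> t; rewrite [x + s *: E l + t *: E i]addrAC; exact: HB.
Qed.

Lemma line_integral_smoothC h i G : measurable G -> Test h -> smoothC (line_integral i G h).
Proof.
move=> mD Hh n; elim: n h Hh => [|n IH] h Hh.
  by have [_ [A hA]] := Hh; split => //; apply: line_integral_cont hA => //; exact: Cinf_cont Hh.1.
have [_ [A hA]] := Hh.
apply: CkS => [|l]; first by apply: line_integral_cont hA => //; exact: Cinf_cont Hh.1.
exists (line_integral i G (D l h)); last by apply: IH; exact: Test_D.
by move=> x; exact: line_integral_derive.
Qed.

Lemma line_integral_D h i l G : measurable G -> Test h ->
  D l (line_integral i G h) = line_integral i G (D l h).
Proof. by move=> mD Hh; apply/funext => x; apply: D_is_derive; exact: line_integral_derive. Qed.

Lemma line_integral_FTC h i (c : R) G x : Test h -> 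
  (forall B : R, `|c| < B -> G `&` `[- B, B] = `[- B, c]) ->
  line_integral i G (D i h) x = h (x + c *: E i).
Proof.
move=> Hh DB; have [_ [A /vanish_ge0 hA]] := Hh.
have N0 := normr_ge0 x; have A0 := normr_ge0 A; have C0 := normr_ge0 c.
pose B := `|A| + `|x| + `|c| + 2.
have Bc : `|c| < B by rewrite /B; lra.
apply: (@Rintegral_FTC _ _ B c (fun t => h (x + t *: E i))).
- by rewrite /B; lra.
- by move: Bc; rewrite ltr_norml => /andP[].
- exact: DB.
- by move=> t; exact: (smoothC_line i x t Hh.1).
- exact: line_cont (Cinf_cont (smoothC_D i Hh.1)).
- by move=> t tB; rewrite (line_vanish i (x:=x) (vanish_D i hA))//; move: tB; rewrite /B; lra.
- have B0 : 0 < B by rewrite /B; lra.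
  by rewrite (line_vanish i (x:=x) hA)// normrN (gtr0_norm B0) /B; lra.
Qed.

End Param.

Section Test1.
Variable R : realType.
Implicit Types th g : R -> R.

Definition Test1 th := C1inf th /\ exists A, vanish1 A th.

Definition deriv1 th : R -> R := fun x => 'D_1 th x.

Lemma Test1_D th : Test1 th -> Test1 (deriv1 th).
Proof.
move=> [Ht [A tA]]; split; first exact: C1inf_D.
exists (A + 1) => x xA; suff [_ //] : is_derive x 1 th 0.
apply: derive_line; apply: (@is_derive_quad R _ 0 0) => s s1.
have z r : `|r| <= 1 -> th (x + r *: 1) = 0.
  move=> r1; apply: tA; rewrite [r *: 1]mulr1.
  have : `|x| <= `|x + r| + `|r| by rewrite -{1}(addrK r x); exact: ler_normB.
  lra.
by rewrite !z ?normr0// mulr0 !subr0 normr0 mul0r.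
Qed.

Lemma Test1_mul th g : C1inf g -> Test1 th -> Test1 (fun x => g x * th x).
Proof.
move=> Hg [Ht [A tA]]; split; first exact: CinfM.
by exists A => x xA; rewrite tA// mulr0.
Qed.

Lemma Test1_scale th (c : R) : Test1 th -> Test1 (fun x => c * th x).
Proof. by move=> Ht; apply: Test1_mul => //; exact: Cinf_cst. Qed.

Lemma Test1_sub th g : Test1 th -> Test1 g -> Test1 (fun x => th x - g x).
Proof.
move=> [Ht [A tA]] /(Test1_scale (-1)) [Hg [B gB]]; split.
  have -> : (fun x => th x - g x) = fun x => th x + -1 * g x.
    by apply/funext => x; rewrite mulN1r.
  exact: CinfDr.
exists (Num.max A B) => x; rewrite gt_max => /andP[xA xB].
by rewrite tA// -mulN1r gB// addr0.
Qed.

Lemma Test1_iter th n : Test1 th -> Test1 (iter n deriv1 th).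
Proof. by move=> Ht; elim: n => //= n; exact: Test1_D. Qed.

End Test1.

Section Coordinate.
Variables (R : realType) (d : nat).
Local Notation V := 'rV[R]_d.
Local Notation mu := (@lebesgue_measure R).
Local Notation E := (@E R d).
Implicit Types (h u w : V -> R) (x y : V) (i l : 'I_d).

Definition on_coord (th : R -> R) i : V -> R := fun x => th (x ord0 i).

Lemma coord_line x i l (r : R) : (x + r *: E l) ord0 i = x ord0 i + r * (i == l)%:R.
Proof. by rewrite !mxE eqxx. Qed.

Lemma on_coord_derive th i l x : C1inf th ->
  is_derive x (E l) (on_coord th i) ((i == l)%:R * 'D_1 th (x ord0 i)).
Proof.
move=> Ht; apply: derive_line; rewrite /on_coord.
under eq_fun do rewrite coord_line.
case: eqP => _; last first.
  rewrite mul0r; under eq_fun do rewrite mulr0 addr0; exact: is_derive_cst.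
rewrite mul1r; have := C1inf_derive (x ord0 i + (0 : R) *: 1) Ht.
rewrite {2}scale0r addr0 => /is_derive_line.
by under eq_fun do rewrite [_ *: 1]mulr1; under eq_fun do rewrite -[X in _ + X]mulr1.
Qed.

Lemma on_coord_smoothC th i : C1inf th -> smoothC (on_coord th i).
Proof.
have cc (g : R -> R) : C1inf g -> continuous (on_coord g i).
  move=> hc x; apply: (@continuous_comp _ _ _ (fun x : V => x ord0 i) g).
    exact: coord_continuous.
  exact: (Cinf_cont hc).
move=> Ht n; elim: n th Ht => [|n IH] th Ht; first by split => //; exact: cc.
apply: CkS => [|l]; first exact: cc.
exists (fun x => (i == l)%:R * 'D_1 th (x ord0 i)); first by move=> x; exact: on_coord_derive.
apply: CkM; first exact: Ck_cst.
by have := IH _ (C1inf_D Ht).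
Qed.

Lemma on_coord_D th i : C1inf th -> D i (on_coord th i) = on_coord (deriv1 th) i.
Proof.
by move=> Ht; apply/funext => x; rewrite (D_is_derive (on_coord_derive i i x Ht)) eqxx mul1r.
Qed.

Lemma norm_gt_coord x (A : R) : 0 <= A -> A < `|x| -> exists i, A < `|x ord0 i|.
Proof.
move=> A0 Ax; apply: contrapT => H; move: Ax; rewrite ltNge => /negP; apply.
by apply: norm_le_coord => // i; rewrite leNgt; apply/negP => K; apply: H; exists i.
Qed.

Definition marginal i h : V -> R := line_integral i (setT : set (measurableTypeR R)) h.
(** The primitive in direction i that vanishes at minus infinity, with t measured from the i-th
    coordinate of x. *)
Definition prim i h : V -> R := line_integral i (`]-oo, 0]%classic : set (measurableTypeR R)) h.

Lemma line_integral_off h (A : R) i l G x : vanish A h -> l != i -> A < `|x ord0 l| ->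
  line_integral i G h x = 0.
Proof.
move=> hA li xl; rewrite /line_integral (_ : (fun t => h (x + t *: E i)) = cst 0).
  by rewrite /Rintegral integral0.
apply/funext => t; rewrite (vanish_coord (i:=l) hA)//.
by rewrite coord_line (negPf li) mulr0 addr0.
Qed.

Lemma marginal_D h i x : Test h -> marginal i (D i h) x = 0.
Proof.
move=> Hh; have [_ [A /vanish_ge0 hA]] := Hh.
have N0 := normr_ge0 x; have A0 := normr_ge0 A.
pose B := `|A| + `|x| + 2.
have B0 : 0 < B by rewrite /B; lra.
have hB t : B <= `|t| -> h (x + t *: E i) = 0.
  by move=> tB; rewrite (line_vanish i (x:=x) hA)//; move: tB; rewrite /B; lra.
rewrite -(hB B) ?gtr0_norm//.
apply: (@Rintegral_FTC _ _ B B (fun t => h (x + t *: E i))) => //.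
- by lra.
- by rewrite setTI.
- by move=> t; exact: (smoothC_line i x t Hh.1).
- exact: line_cont (Cinf_cont (smoothC_D i Hh.1)).
- by move=> t tB; rewrite (line_vanish i (x:=x) (vanish_D i hA))//; move: tB; rewrite /B; lra.
- by rewrite hB// normrN gtr0_norm.
Qed.

Lemma marginal_smoothC h i : Test h -> smoothC (marginal i h).
Proof. by apply: line_integral_smoothC. Qed.

Lemma D_marginal h i : Test h -> D i (marginal i h) = fun=> 0.
Proof.
by move=> Hh; rewrite /marginal line_integral_D//; apply/funext => x; exact: marginal_D.
Qed.

Lemma D_prim h i : Test h -> D i (prim i h) = h.
Proof.
move=> Hh; rewrite /prim line_integral_D//; apply/funext => x.
rewrite (@line_integral_FTC _ _ h i 0)//; first by rewrite scale0r addr0.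
move=> B _; apply/seteqP; split=> t /=; rewrite !in_itv /=.
  by move=> [-> /andP[->]].
by move=> /andP[Bt t0]; rewrite t0 Bt; split => //; lra.
Qed.

Lemma invariant_line g i x (t : R) : smoothC g -> D i g = (fun=> 0) -> g (x + t *: E i) = g x.
Proof.
move=> Hg Dg; apply/eqP; rewrite -subr_eq0 -normr_le0.
have := @mvt_abs R (fun r => g (x + r *: E i)) (fun r => D i g (x + r *: E i)) 0 t.
rewrite scale0r addr0 mul0r; apply => [r|r _]; first exact: (smoothC_line i x r Hg).
by rewrite Dg normr0.
Qed.

(** A marginal is constant in direction i; [th] cuts off that coordinate, and [g] has to be cut off
    only in the others. *)
Lemma Test_on_coord_mul th g (A : R) i : Test1 th -> smoothC g ->
  (forall x l, l != i -> A < `|x ord0 l| -> g x = 0) -> Test (fun x => on_coord th i x * g x).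
Proof.
move=> [Ht [B tB]] Hg gA; split; first by apply: CinfM => //; exact: on_coord_smoothC.
have N0 := normr_ge0 B.
exists (Num.max A `|B|) => x xA.
have [|l] := norm_gt_coord _ xA; first by rewrite le_max normr_ge0 orbT.
rewrite gt_max => /andP[Al Bl]; have [E0|li] := eqVneq l i; last by rewrite (gA x l)// mulr0.
by rewrite /on_coord tB ?mul0r// -E0; have := ler_norm B; lra.
Qed.

Lemma Test_on_coord_marginal th h i : Test1 th -> Test h ->
  Test (fun x => on_coord th i x * marginal i h x).
Proof.
move=> Ht Hh; have [_ [A hA]] := Hh; apply: (@Test_on_coord_mul th _ A) => //.
  exact: marginal_smoothC.
by move=> x l li Al; exact: line_integral_off hA li Al.
Qed.

(** Far out on the positive side the half-line integral is already the full one, which is 0; far out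
    on the negative side the integrand vanishes. *)
Lemma prim_Test h i : Test h -> (forall x, marginal i h x = 0) -> Test (prim i h).
Proof.
move=> Hh T0; have [_ [A /vanish_ge0 hA]] := Hh; split; first exact: line_integral_smoothC.
exists `|A| => x xA; have [l xl] := norm_gt_coord (normr_ge0 A) xA.
have [E0|li] := eqVneq l i; last exact: line_integral_off hA li xl.
rewrite E0 in xl => {l E0}; have hl (t : R) : `|A| < `|x ord0 i + t| -> h (x + t *: E i) = 0.
  by move=> K; rewrite (vanish_coord (i:=i) hA)// coord_line eqxx mulr1.
have N0 := normr_ge0 A.
have [x0|x0] := leP 0 (x ord0 i).
  rewrite -(T0 x) /prim /marginal /line_integral [LHS]Rintegral_mkcond.
  congr Rintegral; apply/funext => t; rewrite patchE; case: ifPn => //.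
  rewrite notin_setE /= in_itv /= => /negP; rewrite -ltNge => t0.
  rewrite (ger0_norm x0) in xl; apply/esym/hl.
  by rewrite (ger0_norm (_ : 0 <= x ord0 i + t)); lra.
rewrite (ltr0_norm x0) in xl.
rewrite /prim /line_integral (@eq_Rintegral _ _ _ _ _ (cst 0)); first by rewrite /Rintegral integral0.
move=> t; rewrite inE /= in_itv /= => t0; apply: hl.
by rewrite (ltr0_norm (_ : x ord0 i + t < 0)); lra.
Qed.

End Coordinate.

(** Both sides are values, at c and at 0, of the marginal of a test function on R^1, which is
    constant because its derivative is 0. *)
Lemma Rintegral_shift (R : realType) (th : R -> R) (c : R) : Test1 th ->
  \int[@lebesgue_measure R]_t th (c + t) = \int[@lebesgue_measure R]_t th t.
Proof.
move=> Ht; pose i0 : 'I_1 := ord0.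
have Th : Test (on_coord th i0).
  have := @Test_on_coord_mul R 1 th (fun=> 1) 0 i0 Ht (@Cinf_cst _ _ _ _ 1).
  by under eq_fun do rewrite mulr1; apply=> x l; rewrite !ord1 eqxx.
have := @invariant_line R 1 (marginal i0 (on_coord th i0)) i0 0 c
  (marginal_smoothC i0 Th) (D_marginal i0 Th).
rewrite /marginal /line_integral /on_coord; under eq_Rintegral do rewrite !coord_line eqxx !mulr1 mxE add0r.
by under [X in _ = X -> _]eq_Rintegral do rewrite coord_line eqxx mulr1 mxE add0r.
Qed.

(** * Moments and the decomposition of test functions in one coordinate *)

Section Decomposition.
Variables (R : realType) (d : nat).
Local Notation V := 'rV[R]_d.
Local Notation mu := (@lebesgue_measure R).
Local Notation E := (@E R d).
Implicit Types (u w : V -> R) (th : R -> R) (x y : V) (i l : 'I_d).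

Lemma marginal_add i u w : Test u -> Test w ->
  marginal i (fun x => u x + w x) = fun x => marginal i u x + marginal i w x.
Proof.
move=> [Hu [A uA]] [Hw [B wB]]; apply: (@line_integral_add _ _ _ _ A B) => //; exact: Cinf_cont.
Qed.

Lemma marginal_scale i (c : R) u : Test u -> marginal i (fun x => c * u x) = fun x => c * marginal i u x.
Proof. by move=> [Hu [A uA]]; apply: (@line_integral_scale _ _ _ _ A) => //; exact: Cinf_cont. Qed.

Lemma marginal_on_coord_mul th i g x : Test1 th -> smoothC g -> D i g = (fun=> 0) ->
  marginal i (fun x => on_coord th i x * g x) x = (\int[mu]_t th t) * g x.
Proof.
move=> Ht Hg Dg; rewrite -(Rintegral_shift (x ord0 i) Ht) -RintegralZr//; last first.
  have [Hc [A tA]] := Ht.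
  apply: (@cc_integrable _ _ (A + `|x ord0 i|)) => //.
    have := Cinf_cont (C1inf_affine 1 (x ord0 i) Hc).
    by under eq_fun do rewrite mul1r addrC.
  move=> t At; apply: tA.
  have := ler_normB (x ord0 i + t) (x ord0 i); rewrite [x ord0 i + t - _]addrC addKr; lra.
apply: eq_Rintegral => t _.
by rewrite (invariant_line _ _ Hg Dg) /on_coord coord_line eqxx mulr1.
Qed.

Definition power (j : nat) : R -> R := fun t => t ^+ j.

(** At x + t e_i the weight is (x_i + t)^j, so the result does not depend on x_i. *)
Definition moment i j u : V -> R := marginal i (fun x => on_coord (power j) i x * u x).

Lemma Test_power i j u : Test u -> Test (fun x => on_coord (power j) i x * u x).
Proof. by move=> Hu; apply: Test_mul => //; apply: on_coord_smoothC; exact: C1inf_exp. Qed.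

Lemma moment_smoothC i j u : Test u -> smoothC (moment i j u).
Proof. by move=> Hu; apply: marginal_smoothC; exact: Test_power. Qed.

Lemma D_moment i j u : Test u -> D i (moment i j u) = fun=> 0.
Proof. by move=> Hu; apply: D_marginal; exact: Test_power. Qed.

Lemma moment0 i u : moment i 0 u = marginal i u.
Proof. by rewrite /moment; congr marginal; apply/funext => x; rewrite /on_coord /power mul1r. Qed.

Lemma Test_on_coord_moment th i j u : Test1 th -> Test u ->
  Test (fun x => on_coord th i x * moment i j u x).
Proof. by move=> Ht Hu; apply: Test_on_coord_marginal => //; exact: Test_power. Qed.

(** Integration by parts: the marginal of D_i (x_i^(j+1) u) is 0. *)
Lemma moment_D i j u x : Test u -> moment i j.+1 (D i u) x = - j.+1%:R * moment i j u x.
Proof.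
move=> Hu; have := marginal_D i x (Test_power i j.+1 Hu).
have Sp n : smoothC (on_coord (power n) i) by apply: on_coord_smoothC; exact: C1inf_exp.
rewrite (D_mul i (Sp j.+1) Hu.1) on_coord_D; last exact: C1inf_exp.
have -> : (fun x => on_coord (power j.+1) i x * D i u x + u x * on_coord (deriv1 (power j.+1)) i x) =
  (fun x => on_coord (power j.+1) i x * D i u x + j.+1%:R * (on_coord (power j) i x * u x)).
  apply/funext => y; congr (_ + _); rewrite /on_coord /deriv1 /power exp_derive /GRing.scale /= mulr1.
  by rewrite mulrC mulrA.
rewrite marginal_add; [|exact/Test_power/Test_D|exact/Test_scale/Test_power].
rewrite marginal_scale; last exact: Test_power.
by move=> /eqP; rewrite addr_eq0 => /eqP; rewrite mulNr.
Qed.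

Lemma moment_iterD i n u x : Test u ->
  moment i n (iter n (D i) u) x = (-1) ^+ n * n`!%:R * marginal i u x.
Proof.
move=> Hu; elim: n => [|n IH]; first by rewrite expr0 fact0 !mul1r moment0.
have T : Test (iter n (D i) u) by elim: n {IH} => //= n; exact: Test_D.
by rewrite /= moment_D// IH factS natrM exprS; ring.
Qed.

(** Subtracting [th] times the marginal makes the marginal vanish, so the primitive in direction i
    is a test function. *)
Lemma decompose1 th i u : Test1 th -> \int[mu]_t th t = 1 -> Test u ->
  exists2 w, Test w & u = fun x => on_coord th i x * marginal i u x + D i w x.
Proof.
move=> Ht th1 Hu.
have T := Test_sub Hu (Test_on_coord_marginal i Ht Hu).
exists (prim i (fun x => u x - on_coord th i x * marginal i u x)).
  apply: prim_Test => // x.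
  have -> : (fun x => u x - on_coord th i x * marginal i u x) =
      (fun x => u x + (-1) * (on_coord th i x * marginal i u x)).
    by apply/funext => y; rewrite mulN1r.
  rewrite marginal_add//; last exact/Test_scale/Test_on_coord_marginal.
  rewrite marginal_scale; last exact: Test_on_coord_marginal.
  rewrite marginal_on_coord_mul//; [|exact: marginal_smoothC|exact: D_marginal].
  by rewrite th1 mul1r mulN1r subrr.
by apply/funext => x; rewrite D_prim// addrC subrK.
Qed.

Lemma moment_add i j u w : Test u -> Test w ->
  moment i j (fun x => u x + w x) = fun x => moment i j u x + moment i j w x.
Proof.
move=> Hu Hw; rewrite /moment -marginal_add; try exact: Test_power.
by congr marginal; apply/funext => x; rewrite mulrDr.
Qed.

Lemma Test_sum n (G : nat -> V -> R) : (forall k, Test (G k)) ->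
  Test (fun x => \sum_(k < n) G k x).
Proof.
move=> HG; elim: n => [|n IH].
  by under eq_fun do rewrite big_ord0; exact: Test_0.
by under eq_fun do rewrite big_ord_recr /=; exact: Test_add.
Qed.

Lemma moment_sum i j n (G : nat -> V -> R) x : (forall k, Test (G k)) ->
  moment i j (fun x => \sum_(k < n) G k x) x = \sum_(k < n) moment i j (G k) x.
Proof.
move=> HG; elim: n => [|n IH].
  rewrite big_ord0; under eq_fun do rewrite big_ord0.
  rewrite /moment /marginal /line_integral; under eq_Rintegral do rewrite mulr0.
  by rewrite /Rintegral integral0.
under eq_fun do rewrite big_ord_recr /=.
rewrite moment_add//; last exact: Test_sum.
by rewrite IH big_ord_recr.
Qed.

Lemma moment_on_coord_mul th i j g x : Test1 th -> smoothC g -> D i g = (fun=> 0) ->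
  moment i j (fun x => on_coord th i x * g x) x = (\int[mu]_t (t ^+ j * th t)) * g x.
Proof.
move=> Ht Hg Dg.
rewrite -(@marginal_on_coord_mul (fun t => t ^+ j * th t) i g x)//; last first.
  by apply: Test1_mul => //; exact: C1inf_exp.
by rewrite /moment; congr marginal; apply/funext => y; rewrite mulrA.
Qed.

Lemma iterD_on_coord_mul th i n g : Test1 th -> smoothC g -> D i g = (fun=> 0) ->
  iter n (D i) (fun x => on_coord th i x * g x) =
  fun x => on_coord (iter n (@deriv1 R) th) i x * g x.
Proof.
move=> Ht Hg Dg; elim: n => //= n ->.
have T : Test1 (iter n (@deriv1 R) th) by exact: Test1_iter.
rewrite (D_mul i (on_coord_smoothC i T.1) Hg) Dg on_coord_D; last exact: T.1.
by apply/funext => x; rewrite mulr0 add0r mulrC.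
Qed.

(* Induction on n: the marginal of the remainder w is read off from the n-th moment of u,
   because the n-th moment of the n-th derivative of w is (-1)^n n! times the marginal of w. *)
Lemma decompose (n : nat) th : Test1 th -> \int[mu]_t th t = 1 ->
  exists2 ths : nat -> R -> R, forall j, Test1 (ths j) &
  forall i u, Test u -> exists2 w, Test w &
    u = fun x => \sum_(j < n) on_coord (ths j) i x * moment i j u x + iter n (D i) w x.
Proof.
move=> Ht th1; elim: n => [|n [ths Hths IH]].
  exists (fun=> th) => // i u Hu; exists u => //.
  by apply/funext => x; rewrite big_ord0 add0r.
(* The inverse of the factor (-1)^n n! of [moment_iterD]. *)
pose c : R := (-1) ^+ n / n`!%:R.
have cE : c * ((-1) ^+ n * n`!%:R) = 1.
  rewrite /c mulrACA -exprMn mulrNN mulr1 expr1n mul1r mulVf// pnatr_eq0 -lt0n fact_gt0//.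
pose thn : R -> R := fun t => c * iter n (@deriv1 R) th t.
pose m j := \int[mu]_t (t ^+ n * ths j t).
have Tn : Test1 thn by apply: Test1_scale; exact: Test1_iter.
(* The marginal of w is c times the n-th moment of u minus the sum of the m_j times the lower
   moments; these corrections are absorbed into the lower functions. *)
exists (fun j => if j == n then thn else fun t => ths j t - m j * thn t).
  by move=> j; case: eqP => // _; apply: Test1_sub => //; exact: Test1_scale.
move=> i u Hu; have [w Hw uE] := IH i u Hu.
have [v Hv wE] := decompose1 i Ht th1 Hw; exists v => //.
have Tw : Test (iter n (D i) w) by elim: n {IH c cE thn m Tn uE} => //= n; exact: Test_D.
have Tv : Test (iter n.+1 (D i) v) by elim: n.+1 => //= k; exact: Test_D.
have tw x : marginal i w x = c * (moment i n u x - \sum_(j < n) m j * moment i j u x).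
  have -> : moment i n u x = \sum_(j < n) m j * moment i j u x + (-1) ^+ n * n`!%:R * marginal i w x.
    pose g k x := on_coord (ths k) i x * moment i k u x.
    have Tg k : Test (g k) by exact: Test_on_coord_moment.
    rewrite {1}uE (moment_add i n (Test_sum n Tg) Tw) moment_iterD// (moment_sum i n n x Tg).
    congr (_ + _); apply: eq_bigr => j _.
    by rewrite moment_on_coord_mul//; [exact: moment_smoothC|exact: D_moment].
  by rewrite addrAC subrr add0r mulrA cE mul1r.
have wnE x : iter n (D i) w x = on_coord (iter n (@deriv1 R) th) i x * marginal i w x + iter n.+1 (D i) v x.
  have Ta k p q : Test p -> Test q ->
      iter k (D i) (fun x => p x + q x) = fun x => iter k (D i) p x + iter k (D i) q x.
    move=> Hp Hq; elim: k => //= k ->; rewrite D_add//.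
      by have [] : Test (iter k (D i) p) by elim: k => //= k; exact: Test_D.
    by have [] : Test (iter k (D i) q) by elim: k => //= k; exact: Test_D.
  rewrite {1}wE Ta; [|exact: Test_on_coord_marginal|exact: Test_D].
  by rewrite iterD_on_coord_mul ?iterSr//; [exact: marginal_smoothC|exact: D_marginal].
apply/funext => x; rewrite {1}uE wnE tw big_ord_recr /= eqxx.
have -> : \sum_(j < n) on_coord (if val j == n then thn else fun t => ths j t - m j * thn t) i x *
      moment i j u x =
    \sum_(j < n) on_coord (ths j) i x * moment i j u x -
      on_coord thn i x * \sum_(j < n) m j * moment i j u x.
  rewrite mulr_sumr -sumrB; apply: eq_bigr => j _; rewrite (ltn_eqF (ltn_ord j)).
  by rewrite /on_coord; ring.
set p := \sum_(j < n) _; set q := \sum_(j < n) _.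
rewrite /on_coord /thn; move: p q (moment i n u x) (D i (iter n (D i) v) x) => *; ring.
Qed.

End Decomposition.

(** * Iterated integrals *)

Section IteratedIntegral.
Variable R : realType.
Local Notation mu := (@lebesgue_measure R).

Definition Cc (d : nat) (h : 'rV[R]_d -> R) := continuous h /\ exists A, vanish A h.

(* The splitting of 'rV_d.+1 used by integral_rV *)
Definition vcons (d : nat) (t : R) (v : 'rV[R]_d) : 'rV[R]_d.+1 := row_mx (t%:M : 'rV[R]_1) v.

Lemma vcons0 d t (v : 'rV[R]_d) : vcons t v ord0 ord0 = t.
Proof.
rewrite /vcons mxE; case: splitP => [j _|k /= /eqP]; last by rewrite eq_sym addn_eq0.
by rewrite (ord1 j) mxE /= mulr1n.
Qed.

Lemma vcons_lift d t (v : 'rV[R]_d) i : vcons t v ord0 (lift ord0 i) = v ord0 i.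
Proof.
rewrite /vcons mxE; case: splitP => [j /= E|k /= E]; first by have := ltn_ord j; rewrite -E.
by congr (v _ _); apply/val_inj; move: E; rewrite /bump /= => -[].
Qed.

Lemma vcons_eta d (x : 'rV[R]_d.+1) : x = vcons (x ord0 ord0) (\row_i x ord0 (lift ord0 i)).
Proof.
apply/rowP => i; have [j ->|->] := unliftP ord0 i; last by rewrite vcons0.
by rewrite vcons_lift mxE.
Qed.

Lemma vcons_eq d (x : 'rV[R]_d.+1) t (v : 'rV[R]_d) :
  x ord0 ord0 = t -> (forall i, x ord0 (lift ord0 i) = v ord0 i) -> x = vcons t v.
Proof.
move=> x0 xi; rewrite (vcons_eta x) x0; congr vcons.
by apply/rowP => i; rewrite mxE xi.
Qed.

Lemma norm_vcons_le d t (v : 'rV[R]_d) (A : R) : `|t| <= A -> `|v| <= A -> `|vcons t v| <= A.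
Proof.
move=> tA vA; have A0 : 0 <= A := le_trans (normr_ge0 _) tA.
apply: norm_le_coord => // i; have [j ->|->] := unliftP ord0 i; last by rewrite vcons0.
by rewrite vcons_lift (le_trans (coord_le_norm v j)).
Qed.

Lemma norm_vcons_l d t (v : 'rV[R]_d) : `|t| <= `|vcons t v|.
Proof. by have := coord_le_norm (vcons t v) ord0; rewrite vcons0. Qed.

Lemma norm_vcons_r d t (v : 'rV[R]_d) : `|v| <= `|vcons t v|.
Proof.
apply: norm_le_coord => // i.
by have := coord_le_norm (vcons t v) (lift ord0 i); rewrite vcons_lift.
Qed.

Lemma rowB_coord n (x y : 'rV[R]_n) i : (x - y) ord0 i = x ord0 i - y ord0 i.
Proof. by rewrite !mxE. Qed.

Lemma vconsB d t s (v w : 'rV[R]_d) : vcons t v - vcons s w = vcons (t - s) (v - w).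
Proof.
apply: vcons_eq => [|i]; first by rewrite rowB_coord !vcons0.
by rewrite !rowB_coord !vcons_lift.
Qed.

Lemma Cc_vanish_ge0 d (h : 'rV[R]_d -> R) : Cc h ->
  continuous h /\ exists2 A, 0 <= A & vanish A h.
Proof. by move=> [hc [A hA]]; split => //; exists `|A|; last exact: vanish_ge0. Qed.

Lemma Cc_add d (h g : 'rV[R]_d -> R) : Cc h -> Cc g -> Cc (fun x => h x + g x).
Proof.
move=> [hc [A hA]] [gc [B gB]]; split.
  by move=> x; apply: continuousD; [exact: hc|exact: gc].
exists (Num.max A B) => x; rewrite gt_max => /andP[Ax Bx].
by rewrite hA// gB// addr0.
Qed.

Lemma Cc_mul d (h g : 'rV[R]_d -> R) : continuous h -> Cc g -> Cc (fun x => h x * g x).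
Proof.
move=> hc [gc [B gB]]; split.
  by move=> x; apply: continuousM; [exact: hc|exact: gc].
by exists B => x Bx; rewrite gB// mulr0.
Qed.

Lemma Cc_scale d c (g : 'rV[R]_d -> R) : Cc g -> Cc (fun x => c * g x).
Proof. by apply: Cc_mul; exact: cst_continuous. Qed.

Lemma Cc_vcons d (h : 'rV[R]_d.+1 -> R) t : Cc h -> Cc (fun v => h (vcons t v)).
Proof.
move=> [hc [A hA]]; split; last first.
  by exists A => v Av; apply: hA; exact: lt_le_trans (norm_vcons_r t v).
move=> v; apply/(@cvgrPdist_le _ _ _ _ (nbhs_filter v)) => e e0.
have [r r0 Hr] := cc_unif hc hA e0.
apply: (@filterS _ _ (nbhs_filter v) _ _ _ (near_dist v r0)) => w vw; apply: Hr.
rewrite vconsB subrr; apply: le_lt_trans vw; apply: norm_vcons_le => //.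
by rewrite normr0.
Qed.

Lemma integral_rVS d (h : 'rV[R]_d.+1 -> R) :
  integral_rV h = \int[mu]_t integral_rV (fun v => h (vcons t v)).
Proof. by []. Qed.

(* Proved together by induction on d: the bound gives the continuity of the slices, needed for
   their integrability and thus for linearity in the next dimension. *)
Record integral_rV_spec (d : nat) : Prop := {
  spec_bound : forall (h : 'rV[R]_d -> R) (A M : R), continuous h -> vanish A h -> 0 <= A ->
    (forall x, `|h x| <= M) -> `|integral_rV h| <= (2 * A) ^+ d * M;
  spec_add : forall h g : 'rV[R]_d -> R, Cc h -> Cc g ->
    integral_rV (fun x => h x + g x) = integral_rV h + integral_rV g;
  spec_scale : forall c (h : 'rV[R]_d -> R), Cc h ->
    integral_rV (fun x => c * h x) = c * integral_rV h }.

Lemma spec_slice d (h : 'rV[R]_d.+1 -> R) (A : R) : integral_rV_spec d ->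
  continuous h -> vanish A h -> 0 <= A ->
  continuous (fun t => integral_rV (fun v => h (vcons t v))) /\
  vanish1 A (fun t => integral_rV (fun v => h (vcons t v))).
Proof.
move=> Hd hc hA A0; have hC : Cc h by split => //; exists A.
split; last first.
  move=> t At.
  (* Homogeneity with factor 0 gives the integral of the zero function. *)
  have -> : (fun v => h (vcons t v)) = fun v => 0 * h (vcons t v).
    by apply/funext => v; rewrite mul0r hA//; exact: lt_le_trans (norm_vcons_l t v).
  by rewrite (spec_scale Hd) ?mul0r//; exact: Cc_vcons.
suff H (t : R) (e : R) : 0 < e -> exists2 r : R, 0 < r & forall s : R, `|t - s| < r ->
    `|integral_rV (fun v => h (vcons t v)) - integral_rV (fun v => h (vcons s v))| <= e.
  move=> t; apply/(@cvgrPdist_le _ _ _ _ (nbhs_filter t)) => e e0.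
  have [r r0 Hr] := H t e e0.
  have Fr : \forall s \near t, `|t - s| < r by apply/nbhs_normP; exists r.
  by apply: (@filterS _ _ (nbhs_filter t) _ _ _ Fr) => s; exact: Hr.
move=> e0; have k0 : 0 < (2 * A) ^+ d + 1 by rewrite ltr_wpDl// exprn_ge0// mulr_ge0.
have [r r0 Hr] := cc_unif hc hA (divr_gt0 e0 k0).
exists r => // s ts.
have Cs u : Cc (fun v => h (vcons u v)) by exact: Cc_vcons.
rewrite -[integral_rV (fun v => h (vcons s v))]mul1r -mulNr -(spec_scale Hd)//.
rewrite -(spec_add Hd)//; last exact: Cc_scale.
apply: (@le_trans _ _ ((2 * A) ^+ d * (e / ((2 * A) ^+ d + 1)))); last first.
  rewrite mulrCA -[leRHS]mulr1 ler_pM2l// ler_pdivrMr// mul1r; lra.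
apply: (spec_bound Hd) => //.
- have [] // := Cc_add (Cs t) (Cc_scale (-1) (Cs s)).
- by move=> v Av; rewrite !hA ?mulr0 ?addr0//; exact: lt_le_trans (norm_vcons_r _ v).
- move=> v; rewrite mulN1r; apply: Hr; rewrite vconsB subrr.
  by apply: le_lt_trans ts; apply: norm_vcons_le => //; rewrite normr0.
Qed.

Lemma integral_rV_specP d : integral_rV_spec d.
Proof.
elim: d => [|d Hd].
  split => [h A M _ _ _ hM|h g _ _|c h _] //=; by rewrite expr0 mul1r.
have slice (h : 'rV[R]_d.+1 -> R) : Cc h ->
    mu.-integrable setT (EFin \o (fun t => integral_rV (fun v => h (vcons t v)))).
  move=> /Cc_vanish_ge0 [hc [A A0 hA]]; have [c v] := spec_slice Hd hc hA A0.
  by apply: (cc_integrable _ c v).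
split.
- move=> h A M hc hA A0 hM; rewrite integral_rVS.
  have [c v] := spec_slice Hd hc hA A0.
  rewrite exprS -mulrA; apply: Rintegral_le_sup => // t.
  have [] := @Cc_vcons d h t; first by split => //; exists A.
  move=> sc _; apply: (spec_bound Hd) => //.
  by move=> w Aw; apply: hA; exact: lt_le_trans (norm_vcons_r t w).
- move=> h g hC gC; rewrite !integral_rVS.
  rewrite -(RintegralD _ (slice h hC) (slice g gC))//.
  by apply: eq_Rintegral => t _; apply: (spec_add Hd); exact: Cc_vcons.
- move=> c h hC; rewrite !integral_rVS -(RintegralZl _ _ (slice h hC))//.
  by apply: eq_Rintegral => t _; apply: (spec_scale Hd); exact: Cc_vcons.
Qed.

Lemma integral_rV_bound d (h : 'rV[R]_d -> R) (A M : R) : continuous h -> vanish A h -> 0 <= A ->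
  (forall x, `|h x| <= M) -> `|integral_rV h| <= (2 * A) ^+ d * M.
Proof. exact: spec_bound (integral_rV_specP d) _ _ _. Qed.

Lemma integral_rV_add d (h g : 'rV[R]_d -> R) : Cc h -> Cc g ->
  integral_rV (fun x => h x + g x) = integral_rV h + integral_rV g.
Proof. exact: spec_add (integral_rV_specP d) _ _. Qed.

Lemma integral_rV_scale d c (h : 'rV[R]_d -> R) : Cc h ->
  integral_rV (fun x => c * h x) = c * integral_rV h.
Proof. exact: spec_scale (integral_rV_specP d) _ _. Qed.

Lemma integral_slice d (h : 'rV[R]_d.+1 -> R) : Cc h ->
  continuous (fun t => integral_rV (fun v => h (vcons t v))) /\
  exists A, vanish1 A (fun t => integral_rV (fun v => h (vcons t v))).
Proof.
move=> /Cc_vanish_ge0 [hc [A A0 hA]].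
by have [c v] := spec_slice (integral_rV_specP d) hc hA A0; split => //; exists A.
Qed.

Lemma Cc_0 d : @Cc d (fun=> 0).
Proof. by split; [exact: cst_continuous|exists 0]. Qed.

Lemma integral_rV_0 d : integral_rV (fun _ : 'rV[R]_d => 0 : R) = 0.
Proof.
by have := integral_rV_scale 0 (@Cc_0 d); rewrite !mul0r.
Qed.

Lemma Cc_sum d (I : Type) (r : seq I) (G : I -> 'rV[R]_d -> R) : (forall k, Cc (G k)) ->
  Cc (fun x => \sum_(k <- r) G k x).
Proof.
move=> HG; elim: r => [|k r IH].
  by under eq_fun do rewrite big_nil; exact: Cc_0.
by under eq_fun do rewrite big_cons; exact: Cc_add.
Qed.

Lemma integral_rV_sum d (I : Type) (r : seq I) (G : I -> 'rV[R]_d -> R) : (forall k, Cc (G k)) ->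
  integral_rV (fun x => \sum_(k <- r) G k x) = \sum_(k <- r) integral_rV (G k).
Proof.
move=> HG; elim: r => [|k r IH].
  by rewrite big_nil; under eq_fun do rewrite big_nil; exact: integral_rV_0.
rewrite big_cons; under eq_fun do rewrite big_cons.
by rewrite integral_rV_add ?IH//; exact: Cc_sum.
Qed.

Lemma Test_Cc d (u : 'rV[R]_d -> R) : Test u -> Cc u.
Proof. by move=> [Hu HA]; split => //; exact: Cinf_cont Hu. Qed.

End IteratedIntegral.

Definition Cc1 (R : realType) (h : R -> R) := continuous h /\ exists A, vanish1 A h.

Lemma Cc1_add (R : realType) (h g : R -> R) : Cc1 h -> Cc1 g -> Cc1 (fun t => h t + g t).
Proof.
move=> [hc [A hA]] [gc [B gB]]; split.
  by move=> x; apply: continuousD; [exact: hc|exact: gc].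
exists (Num.max A B) => x; rewrite gt_max => /andP[Ax Bx].
by rewrite hA// gB// addr0.
Qed.

Lemma Cc1_scale (R : realType) (h : R -> R) c : Cc1 h -> Cc1 (fun t => c * h t).
Proof.
move=> [hc [A hA]]; split; first exact: scale_cont.
by exists A => x Ax; rewrite hA// mulr0.
Qed.

Lemma Rintegral_Cc1_sum (R : realType) (n : nat) (c : nat -> R) (h : nat -> R -> R) :
  (forall j, Cc1 (h j)) ->
  \int[@lebesgue_measure R]_t (\sum_(j < n) c j * h j t) =
  \sum_(j < n) c j * \int[@lebesgue_measure R]_t h j t.
Proof.
move=> Hh.
have I (g : R -> R) : Cc1 g -> (@lebesgue_measure R).-integrable setT (EFin \o g).
  by move=> [gc [A gA]]; exact: (cc_integrable _ gc gA).
have S k : Cc1 (fun t => \sum_(j < k) c j * h j t).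
  elim: k => [|k IH].
    under eq_fun do rewrite big_ord0; split; first exact: cst_continuous.
    by exists 0.
  by under eq_fun do rewrite big_ord_recr /=; apply: Cc1_add => //; exact: Cc1_scale.
elim: n => [|n IH].
  by rewrite big_ord0; under eq_Rintegral do rewrite big_ord0; rewrite /Rintegral integral0.
under eq_Rintegral do rewrite big_ord_recr /=.
rewrite (RintegralD _ (I _ (S n)) (I _ (Cc1_scale (c n) (Hh n))))// IH big_ord_recr /=.
by rewrite (RintegralZl _ _ (I _ (Hh n))).
Qed.

(** * Taking out the coordinates one after the other *)

Section Peel.
Variables (R : realType) (n : nat) (ths : nat -> R -> R).
Local Notation mu := (@lebesgue_measure R).
Hypothesis Hths : forall j, Test1 (ths j).

Definition moment_kernel (a t : R) : R := \sum_(j < n) ths j a * t ^+ j.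

(** The sum over the moments in [decompose] as one integral. Here t is the i-th coordinate itself,
    not an offset from x_i, so that iterating over the coordinates yields [integral_rV] directly. *)
Definition peel (d : nat) (i : 'I_d) (u : 'rV[R]_d -> R) : 'rV[R]_d -> R :=
  fun x => \int[mu]_t (moment_kernel (x ord0 i) t * u (x + (t - x ord0 i) *: E R i)).

Lemma peelE d (i : 'I_d) u x : Test u ->
  peel i u x = \sum_(j < n) on_coord (ths j) i x * moment i j u x.
Proof.
(* x with its i-th coordinate set to 0: the moments are the same there, and along the line from x0
   the parameter is the coordinate. *)
move=> Hu; pose x0 := x + (- x ord0 i) *: E R i.
have x0i : x0 ord0 i = 0 by rewrite coord_line eqxx mulr1 subrr.
have mE j : moment i j u x = \int[mu]_t (t ^+ j * u (x0 + t *: E R i)).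
  rewrite -(invariant_line x (- x ord0 i) (moment_smoothC i j Hu) (D_moment i j Hu)) -/x0.
  rewrite /moment /marginal /line_integral; apply: eq_Rintegral => t _.
  by rewrite /on_coord /power coord_line x0i eqxx mulr1 add0r.
have uC j : Cc1 (fun t => t ^+ j * u (x0 + t *: E R i)).
  have [_ [A uA]] := Test_power i j Hu; split; last first.
    exists (A + `|x0|) => t At; have := line_vanish i uA At.
    by rewrite /on_coord /power coord_line x0i eqxx mulr1 add0r.
  have := @line_cont _ _ _ i x0 (Cinf_cont (Test_power i j Hu).1).
  by under eq_fun do rewrite /on_coord /power coord_line x0i eqxx mulr1 add0r.
transitivity (\sum_(j < n) ths j (x ord0 i) * \int[mu]_t (t ^+ j * u (x0 + t *: E R i))).
  apply: (etrans _ (Rintegral_Cc1_sum n (fun j => ths j (x ord0 i)) uC)).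
  apply: eq_Rintegral => t _.
  rewrite /moment_kernel mulr_suml; apply: eq_bigr => j _; rewrite -mulrA; congr (_ * (_ * u _)).
  by rewrite /x0 -addrA -scalerDl [- _ + t]addrC.
by apply: eq_bigr => j _; rewrite mE.
Qed.

Lemma Test_peel d (i : 'I_d) u : Test u -> Test (peel i u).
Proof.
move=> Hu; rewrite (_ : peel i u = fun x => \sum_(j < n) on_coord (ths j) i x * moment i j u x).
  apply: (@Test_sum _ _ n (fun j x => on_coord (ths j) i x * moment i j u x)) => j.
  exact: Test_on_coord_moment.
by apply/funext => x; rewrite peelE.
Qed.

(** Peeling the later coordinates leaves the first one as a parameter, which permits the induction
    on d. *)
Lemma foldr_peel_vcons d (s : seq 'I_d) (u : 'rV[R]_d.+1 -> R) t v :
  foldr (@peel d.+1) u (map (lift ord0) s) (vcons t v) =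
  foldr (@peel d) (fun w => u (vcons t w)) s v.
Proof.
elim: s v => //= i s IH v; rewrite {1 3}/peel; apply: eq_Rintegral => r _.
rewrite vcons_lift -IH.
suff -> : vcons t v + (r - v ord0 i) *: E R (lift ord0 i) =
  vcons t (v + (r - v ord0 i) *: E R i) by [].
apply: vcons_eq => [|j]; first by rewrite coord_line vcons0 mulr0 addr0.
by rewrite !coord_line !vcons_lift (inj_eq (@lift_inj _ _)).
Qed.

Lemma continuous_moment_kernel a : continuous (moment_kernel a).
Proof.
rewrite /moment_kernel; elim: n => [|m IH].
  by under eq_fun do rewrite big_ord0; exact: cst_continuous.
under eq_fun do rewrite big_ord_recr /=; apply: add_cont; first exact: IH.
apply: scale_cont; exact: (Cinf_cont (@C1inf_exp R m)).
Qed.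

Lemma continuous_moment_kernel_prod d (x : 'rV[R]_d) :
  continuous (fun y : 'rV[R]_d => \prod_i moment_kernel (x ord0 i) (y ord0 i)).
Proof.
elim: (index_enum 'I_d) => [|i r IH].
  by under eq_fun do rewrite big_nil; exact: cst_continuous.
under eq_fun do rewrite big_cons; apply: mul_cont; last exact: IH.
move=> y; apply: (@continuous_comp _ _ _ (fun y : 'rV[R]_d => y ord0 i) (moment_kernel (x ord0 i))).
  exact: coord_continuous.
exact: continuous_moment_kernel.
Qed.

(* The coordinates are peeled in the order of the iterated integral, so Fubini is not needed. *)
Lemma foldr_peel d (u : 'rV[R]_d -> R) x : Cc u ->
  foldr (@peel d) u (enum 'I_d) x =
  integral_rV (fun y => (\prod_i moment_kernel (x ord0 i) (y ord0 i)) * u y).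
Proof.
elim: d u x => [|d IH] u x Hu.
  rewrite (size0nil (_ : size (enum 'I_0) = 0%N)) ?size_enum_ord//= big_ord0 mul1r.
  by congr u; apply/rowP => -[].
rewrite enum_ordSl [LHS]/= integral_rVS /peel -/(@peel d.+1).
apply: eq_Rintegral => t _.
pose v := \row_i x ord0 (lift ord0 i).
have -> : x + (t - x ord0 ord0) *: E R ord0 = vcons t v.
  apply: vcons_eq => [|i]; first by rewrite coord_line eqxx mulr1 addrC subrK.
  by rewrite coord_line mulr0 addr0 mxE.
rewrite foldr_peel_vcons IH; last exact: Cc_vcons.
rewrite -integral_rV_scale; last by apply: Cc_mul; [exact: continuous_moment_kernel_prod|exact: Cc_vcons].
congr integral_rV; apply/funext => w; rewrite mulrA big_ord_recl vcons0; congr (_ * _ * _).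
by apply: eq_bigr => i _; rewrite vcons_lift mxE.
Qed.

Lemma functional_peel d (F : ('rV[R]_d -> R) -> R[i]) : 
  (forall i u, Test u -> F (peel i u) = F u) ->
  forall u, Test u -> F u =
    F (fun x => integral_rV (fun y => (\prod_i moment_kernel (x ord0 i) (y ord0 i)) * u y)).
Proof.
move=> HF u Hu.
have -> : (fun x : 'rV[R]_d => integral_rV (fun y : 'rV[R]_d =>
      (\prod_i moment_kernel (x ord0 i) (y ord0 i)) * u y)) =
    foldr (@peel d) u (enum 'I_d).
  by apply/funext => x; rewrite foldr_peel//; exact: Test_Cc.
suff [] : F u = F (foldr (@peel d) u (enum 'I_d)) /\ Test (foldr (@peel d) u (enum 'I_d)) by [].
elim: (enum 'I_d) => //= i s [IH T]; rewrite HF//; split => //; exact: Test_peel.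
Qed.

End Peel.

(** * Bump functions *)

Section Bump.
Variable R : realType.
Implicit Types (p : {poly R}) (t : R).

(** Every derivative of exp(-1/t) is a polynomial in 1/t times exp(-1/t); carrying the polynomial
    closes the family under differentiation, p becoming X^2 (p - p'). *)
Definition flat p t : R := if 0 < t then p.[t^-1] * expR (- t^-1) else 0.

Lemma horner_le_expR p : exists2 C : R, 0 <= C & forall s : R, 0 <= s -> `|p.[s]| <= C * expR s.
Proof.
exists (\sum_(i < size p) `|p`_i| * i`!%:R).
  by apply: sumr_ge0 => i _; rewrite mulr_ge0.
move=> s s0; rewrite horner_coef mulr_suml (le_trans (ler_norm_sum _ _ _))// ler_sum// => i _.
rewrite normrM -mulrA ler_wpM2l// ger0_norm ?exprn_ge0//.
have f0 : 0 < (i : nat)`!%:R :> R by rewrite ltr0n fact_gt0.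
rewrite -ler_pdivrMl// mulrC; case: (val i) {f0} => [|k].
  by rewrite expr0 fact0 divr1 (le_trans _ (expR_ge1Dx s))// lerDl.
by apply: le_trans (expR_ge1Dxn k s0); rewrite lerDr.
Qed.

(** The exponential bound for p X^2 at 1/t; the two extra powers give the quadratic decay that
    [is_derive_quad] needs at 0. *)
Lemma flat_quad p : exists2 C : R, 0 <= C & forall t, `|flat p t| <= C * t ^+ 2.
Proof.
have [C C0 HC] := horner_le_expR (p * 'X^2); exists C => // t; rewrite /flat.
case: ltP => [t0|_]; last by rewrite normr0 mulr_ge0 ?sqr_ge0.
have := HC t^-1; rewrite invr_ge0 (ltW t0) => /(_ isT).
rewrite hornerM hornerXn !(normrM p.[t^-1]) (ger0_norm (expR_ge0 _)) expRN.
rewrite (ger0_norm (sqr_ge0 t^-1)) => H.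
rewrite ler_pdivrMr ?expR_gt0// mulrAC -ler_pdivrMr ?exprn_gt0//.
by rewrite -exprVn.
Qed.

Lemma flat_derive p t : is_derive t 1 (flat p) (flat ('X^2 * (p - p^`())) t).
Proof.
have [t0|t0|<-] := ltgtP 0 t.
- have tn : t != 0 by rewrite gt_eqF.
  have nt : \forall s \near t, p.[s^-1] * expR (- s^-1) = flat p s.
    have : \forall s \near t, `|t - s| < t by apply/nbhs_normP; exists t.
    apply: filterS => s; rewrite ltr_norml => /andP[_ st].
    by rewrite /flat ifT//; lra.
  apply: (near_eq_is_derive nt).
  have iV : is_derive t 1 (fun y : R => y^-1) (- t ^- 2).
    have := @is_deriveV R id t 1 1 tn (is_derive_id _ _).
    by rewrite /GRing.scale /= mulr1.
  have h1 := @is_derive1_comp R (horner p) (fun y => y^-1) t _ _ (is_derive_poly p t^-1) iV.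
  have iN : is_derive t 1 (fun y : R => - y^-1) (t ^- 2).
    by have := is_deriveN iV; rewrite opprK.
  have h2 := @is_derive1_comp R expR (fun y => - y^-1) t _ _ (is_derive_expR _) iN.
  have h3 : is_derive t 1 (fun s => p.[s^-1] * expR (- s^-1))
    (p.[t^-1] * (expR (- t^-1) * t ^- 2) + expR (- t^-1) * (p^`().[t^-1] * - t ^- 2)).
    exact: is_deriveM h1 h2.
  apply: is_derive_eq h3 _; rewrite /flat t0 hornerM hornerXn hornerD hornerN -exprVn.
  by move: (p.[_]) (p^`().[_]) (expR _) => *; ring.
- have nt : \forall s \near t, 0 = flat p s.
    have : \forall s \near t, `|t - s| < - t.
      by apply/nbhs_normP; exists (- t) => //=; rewrite oppr_gt0.
    apply: filterS => s; rewrite ltr_norml => /andP[st _].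
    by rewrite /flat ifF//; apply/negbTE; rewrite -leNgt; lra.
  apply: (near_eq_is_derive nt); rewrite /flat ifF; first exact: is_derive_cst.
  by apply/negbTE; rewrite -leNgt ltW.
- have [C C0 HC] := flat_quad p.
  have z q : flat q 0 = 0 by rewrite /flat ltxx.
  by rewrite z; apply: (@is_derive_quad R _ _ C) => s _; rewrite z subr0 mulr0 subr0.
Qed.

Lemma flat_C1inf p : C1inf (flat p).
Proof.
have fc q : continuous (flat q).
  move=> t; apply/differentiable_continuous/derivable1_diffP.
  by case: (flat_derive q t).
move=> n; elim: n p => [|n IH] p; first by split => //; exact: fc.
apply: CkS => [|_]; first exact: fc.
by exists (flat ('X^2 * (p - p^`()))) => // t; exact: flat_derive.
Qed.

(** Positive exactly on the open interval of radius e around a. The factors 1 and -1 match the form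
    of [C1inf_affine]. *)
Definition bump (a e : R) t : R := flat 1 (1 * t + (e - a)) * flat 1 (- 1 * t + (e + a)).

Lemma flat1_ge0 t : 0 <= flat 1 t.
Proof. by rewrite /flat; case: ifP => // _; rewrite hornerC mul1r expR_ge0. Qed.

Lemma flat1_gt0 t : 0 < t -> 0 < flat 1 t.
Proof. by move=> t0; rewrite /flat t0 hornerC mul1r expR_gt0. Qed.

Lemma bump_C1inf a e : C1inf (bump a e).
Proof. by apply: CinfM; exact: C1inf_affine (flat_C1inf 1). Qed.

Lemma bump_ge0 a e t : 0 <= bump a e t.
Proof. by rewrite mulr_ge0// flat1_ge0. Qed.

Lemma bump_gt0 a e : 0 < e -> 0 < bump a e a.
Proof. by move=> e0; rewrite mulr_gt0// flat1_gt0//; lra. Qed.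

Lemma bump_off a e t : e <= `|t - a| -> bump a e t = 0.
Proof.
rewrite /bump /flat ler_normr => /orP[h|h].
  by rewrite [X in _ * X]ifF ?mulr0//; apply/negbTE; rewrite -leNgt; lra.
by rewrite ifF ?mul0r//; apply/negbTE; rewrite -leNgt; lra.
Qed.

Lemma bump_Test1 a e : Test1 (bump a e).
Proof.
split; first exact: bump_C1inf.
exists (`|e| + `|a|) => t ta; apply: bump_off.
have := ler_normD (t - a) a; rewrite subrK; have := ler_norm e; lra.
Qed.

Lemma Rintegral_gt0 (h : R -> R) (A t0 : R) : continuous h -> vanish1 A h ->
  (forall t, 0 <= h t) -> 0 < h t0 -> 0 < \int[@lebesgue_measure R]_t h t.
Proof.
move=> hc hA h0 ht0.
have e0 : 0 < h t0 / 2 by rewrite divr_gt0.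
have [r r0 Hr] : exists2 r : R, 0 < r & forall t, `|t0 - t| < r -> h t0 / 2 <= h t.
  have /cvgrPdist_le /(_ _ e0) /nbhs_normP[r /= r0 Hr] := hc t0.
  exists r => // t /Hr /=; rewrite ler_norml => /andP[_]; lra.
pose I : set (measurableTypeR R) := `[t0 - r / 2, t0 + r / 2]%classic.
have mI : measurable I by exact: measurable_itv.
have hI : (@lebesgue_measure R).-integrable setT (EFin \o h) by exact: cc_integrable hA.
have muI : (@lebesgue_measure R) I = r%:E.
  rewrite /I lebesgue_measure_itv /= lte_fin ifT; last lra.
  by rewrite -EFinB; congr (_%:E); lra.
have muIy : ((@lebesgue_measure R) I < +oo)%E by rewrite muI ltry.
apply: (@lt_le_trans _ _ (\int[@lebesgue_measure R]_(t in I) (h t0 / 2))).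
  rewrite Rintegral_cst//.
  by have -> : fine ((@lebesgue_measure R) I) = r; [rewrite muI|exact: mulr_gt0].
apply: (@le_trans _ _ (\int[@lebesgue_measure R]_(t in I) h t)).
  apply: le_Rintegral => //.
  - apply: (@measurable_bounded_integrable _ _ _ _ (cst (h t0 / 2))) => //; last exact: bounded_cst.
  - by apply: integrableS hI.
  - move=> t; rewrite /I /= in_itv /= => /andP[l u]; apply: Hr.
    by rewrite ltr_norml; apply/andP; split; lra.
rewrite [leLHS]Rintegral_mkcond; apply: le_Rintegral => //.
- rewrite -restrict_EFin; apply: (iffLR (integrable_mkcond _ _)) => //.
  by apply: integrableS hI.
- by move=> t _; rewrite patchE; case: ifP.
Qed.

Lemma integral_rV_gt0 (d : nat) (h : 'rV[R]_d -> R) (x : 'rV[R]_d) : Cc h ->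
  (forall y, 0 <= h y) -> 0 < h x -> 0 < integral_rV h.
Proof.
elim: d h x => [|d IH] h x hC h0 hx.
  by rewrite /= (_ : 0 = x)//; apply/rowP => -[].
rewrite integral_rVS; have [sc [A sA]] := integral_slice hC.
have nonneg n : forall g : 'rV[R]_n -> R, (forall y, 0 <= g y) -> 0 <= integral_rV g.
  elim: n => [|n IHn] g g0 //=; apply: Rintegral_ge0 => t _; exact: IHn.
apply: (@Rintegral_gt0 _ A (x ord0 ord0)) => //; first by move=> t; exact: nonneg.
apply: (IH _ (\row_i x ord0 (lift ord0 i))); [exact: Cc_vcons|by []|].
by rewrite -vcons_eta.
Qed.

Lemma normalized_bump : exists2 th : R -> R, Test1 th & \int[@lebesgue_measure R]_t th t = 1.
Proof.
have [hc [A hA]] := bump_Test1 0 1.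
have p : 0 < \int[@lebesgue_measure R]_t bump 0 1 t.
  apply: (@Rintegral_gt0 _ A 0) => //; [exact: Cinf_cont hc|exact: bump_ge0|exact: bump_gt0].
exists (fun t => (\int[@lebesgue_measure R]_t bump 0 1 t)^-1 * bump 0 1 t).
  exact/Test1_scale/bump_Test1.
rewrite RintegralZl//; last exact: (cc_integrable _ (Cinf_cont hc) hA).
by rewrite mulVf// gt_eqF.
Qed.

Lemma bump_rV (d : nat) (x : 'rV[R]_d) (r : R) : 0 < r ->
  exists2 u : 'rV[R]_d -> R, Test u &
  [/\ forall y, 0 <= u y, 0 < u x & forall y, r <= `|x - y| -> u y = 0].
Proof.
(* Half the radius leaves room for the strict inequality that [norm_gt_coord] asks for. *)
move=> r0; pose u (y : 'rV[R]_d) := \prod_i on_coord (bump (x ord0 i) (r / 2)) i y.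
have r2 : 0 < r / 2 by rewrite divr_gt0.
have u_off y : r <= `|x - y| -> u y = 0.
  move=> xy; have [|i Hi] := @norm_gt_coord R d (x - y) (r / 2) (ltW r2).
    by apply: lt_le_trans xy; lra.
  rewrite /u (bigD1 i)//= /on_coord bump_off ?mul0r// distrC.
  by rewrite rowB_coord in Hi; exact: ltW.
exists u; last first.
  split => //; first by move=> y; apply: prodr_ge0 => i _; exact: bump_ge0.
  by apply: prodr_gt0 => i _; exact: bump_gt0.
split.
  apply: (@Cinf_prod _ _ _ _ _ _ (fun i => on_coord (bump (x ord0 i) (r / 2)) i)) => i.
  exact: on_coord_smoothC (bump_C1inf _ _).
exists (`|x| + r) => y xy; apply: u_off.
have : `|y| <= `|x - y| + `|x| by rewrite distrC -{1}(subrK x y); exact: ler_normD.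
lra.
Qed.

End Bump.

Lemma meval_monomials (R : realType) (d M : nat) (c : {ffun 'I_d -> 'I_M} -> R[i]) :
  ordinary_polynomial (fun x : 'rV[R]_d =>
    \sum_(f : {ffun 'I_d -> 'I_M}) c f * \prod_i (x ord0 i)%:C ^+ f i).
Proof.
exists (\sum_(f : {ffun 'I_d -> 'I_M}) mpoly.mpolyC d (c f) *
   \prod_i (mpoly.mpolyX R[i] (mpoly.mnm1 i)) ^+ f i) => x.
rewrite rmorph_sum /=; apply: eq_bigr => f _.
rewrite rmorphM /= mpoly.mevalC; congr (_ * _).
rewrite rmorph_prod; apply: eq_bigr => i _.
by rewrite rmorphXn /= mpoly.mevalXU.
Qed.

(** * Polynomial distributions *)

Section Representation.
Variables (R : realType) (d : nat).
Local Notation V := 'rV[R]_d.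
Implicit Types (u w : V -> R) (F : (V -> R) -> R[i]).

Lemma functional_sum F (I : Type) (r : seq I) (a : I -> R) (G : I -> V -> R) :
  real_functional F -> (forall k, Test (G k)) ->
  F (fun x => \sum_(k <- r) a k * G k x) = \sum_(k <- r) (a k)%:C * F (G k).
Proof.
move=> HF HG; suff [] : Test (fun x => \sum_(k <- r) a k * G k x) /\
    F (fun x => \sum_(k <- r) a k * G k x) = \sum_(k <- r) (a k)%:C * F (G k) by [].
elim: r => [|k r [T IH]].
  rewrite big_nil; have -> : (fun x => \sum_(k <- [::]) a k * G k x) = fun=> 0.
    by apply/funext => x; rewrite big_nil.
  by split; [exact: Test_0|exact: functional_0].
have -> : (fun x => \sum_(k <- k :: r) a k * G k x) =
    fun x => a k * G k x + \sum_(k <- r) a k * G k x.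
  by apply/funext => x; rewrite big_cons.
split; first by apply: Test_add => //; exact: Test_scale.
by rewrite (functional_add HF)//; [rewrite (functional_scale HF)// IH big_cons|exact: Test_scale].
Qed.

(** The exponents, all below M, form a finite function: this is the index produced by expanding a
    product over coordinates of sums over j < M. *)
Definition monomial (M : nat) (f : {ffun 'I_d -> 'I_M}) : V -> R :=
  fun y => \prod_i y ord0 i ^+ f i.

Lemma monomial_cont M (f : {ffun 'I_d -> 'I_M}) : continuous (monomial f).
Proof.
apply: Cinf_cont; apply: (@Cinf_prod _ _ _ _ _ _ (fun i => on_coord (fun t => t ^+ f i) i)) => i.
by apply: on_coord_smoothC; exact: C1inf_exp.
Qed.

(** Peeling changes u by an M-th derivative, which F kills. Once all coordinates are peeled, F acts
    on a kernel that expands into finitely many terms Th_f(x) y^f, so the coefficients are the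
    values of F at the fixed test functions Th_f. *)
Lemma functional_polynomial F (M : nat) : real_functional F ->
  (forall i u, Test u -> F (iter M (D i) u) = 0) ->
  exists c : {ffun 'I_d -> 'I_M} -> R[i], forall u, Test u ->
    F u = \sum_f c f * (integral_rV (fun y => monomial f y * u y))%:C.
Proof.
move=> HF FM; have [th Ht th1] := normalized_bump R.
have [ths Hths dec] := @decompose R d M th Ht th1.
have Fp i u : Test u -> F (peel M ths i u) = F u.
  move=> Hu; have [w Hw uE] := dec i u Hu.
  have uE' : u = fun x => peel M ths i u x + iter M (D i) w x.
    by apply/funext => x; rewrite peelE// {1}uE.
  have Tw := Test_iterD M i Hw.
  by rewrite [in RHS]uE' (functional_add HF) ?FM ?addr0//; exact: Test_peel.
pose Th (f : {ffun 'I_d -> 'I_M}) (x : V) := \prod_i on_coord (ths (f i)) i x.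
have TTh f : Test (Th f).
  split.
    apply: (@Cinf_prod _ _ _ _ _ _ (fun i => on_coord (ths (f i)) i)) => i.
    exact: on_coord_smoothC (Hths (f i)).1.
  (* The sum of the radii dominates each of them, so a large norm puts some coordinate outside the
     support of its factor. *)
  pose A := \sum_i `|projT1 (cid (Hths (f i)).2)|.
  have A0 : 0 <= A by apply: sumr_ge0.
  exists A => x /(norm_gt_coord A0)[i Ai].
  rewrite /Th (bigD1 i)//= /on_coord.
  rewrite (_ : ths (f i) (x ord0 i) = 0) ?mul0r//.
  move: Ai; rewrite /A (bigD1 i)//=; case: cid => B tB /= Ai; apply: tB.
  have : 0 <= \sum_(j < d | j != i) `|projT1 (cid (Hths (f j)).2)| by apply: sumr_ge0.
  have := ler_norm B; lra.
exists (fun f => F (Th f)) => u Hu; rewrite (functional_peel Hths Fp)//.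
have Cm (f : {ffun 'I_d -> 'I_M}) : Cc (fun y => monomial f y * u y).
  by apply: Cc_mul; [exact: monomial_cont|exact: Test_Cc].
have -> : (fun x : V => integral_rV (fun y : V =>
      (\prod_i moment_kernel M ths (x ord0 i) (y ord0 i)) * u y)) =
   fun x => \sum_(f : {ffun 'I_d -> 'I_M}) integral_rV (fun y => monomial f y * u y) * Th f x.
  apply/funext => x.
  have -> : (fun y : V => (\prod_i moment_kernel M ths (x ord0 i) (y ord0 i)) * u y) =
      fun y => \sum_(f : {ffun 'I_d -> 'I_M}) Th f x * (monomial f y * u y).
    apply/funext => y; rewrite /moment_kernel bigA_distr_bigA mulr_suml /=.
    by apply: eq_bigr => f _; rewrite big_split /= -mulrA.
  rewrite integral_rV_sum => [|f]; last exact: Cc_scale.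
  by apply: eq_bigr => f _; rewrite integral_rV_scale// mulrC.
by rewrite functional_sum//; apply: eq_bigr => f _; rewrite mulrC.
Qed.

End Representation.

(** * From complex distributions to functionals on real test functions *)

Section TestFunctions.
Variables (R : realType) (d : nat).
Local Notation V := 'rV[R]_d.
Implicit Types (phi psi : V -> R[i]) (u w : V -> R).

Lemma supp_vanish phi (A : R) : supp phi `<=` [set x | `|x| <= A] ->
  forall x, A < `|x| -> phi x = 0.
Proof.
move=> sA x Ax; apply/eqP; apply: contraTT Ax => px; rewrite -leNgt.
by apply: sA; apply: subset_closure.
Qed.

Lemma vanish_supp phi (A : R) : (forall x, A < `|x| -> phi x = 0) ->
  supp phi `<=` [set x | `|x| <= A].
Proof.
move=> pA; have cl := @closed_ball0 R d A.
rewrite [X in _ `<=` X](closure_id _).1//; apply: closure_subset => x /= px.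
by rewrite leNgt; apply: contra px => /pA ->.
Qed.

Lemma compact_sub_ball (K : set V) : compact K -> exists2 A : R, 0 <= A & K `<=` [set x | `|x| <= A].
Proof.
move=> /compact_bounded[M [_ HM]]; exists (`|M| + 1); first by have := normr_ge0 M; lra.
by move=> x Kx; apply: (HM (`|M| + 1)) => //; have := ler_norm M; lra.
Qed.

Lemma test_functionP phi : test_function phi <-> Test (Re_fun phi) /\ Test (Im_fun phi).
Proof.
split=> [[/smoothP sr /smoothP si /compact_sub_ball[A _ /supp_vanish pA]]|].
  by split; split => //; exists A => x /pA E; rewrite /Re_fun /Im_fun E.
move=> [[sr [A rA]] [si [B iB]]]; split; [exact/smoothP|exact/smoothP|].
have := @vanish_supp phi (Num.max A B); set K := [set x | _] => H.
apply: (subclosed_compact (@closed_closure _ _) (@compact_ball0 R d (Num.max A B))).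
apply: H => x; rewrite gt_max => /andP[Ax Bx].
have := rA x Ax; have := iB x Bx; rewrite /Re_fun /Im_fun; case: (phi x) => a b /= -> ->//.
Qed.

Lemma test_real u : Test u -> test_function (fun x => (u x)%:C).
Proof. by move=> Hu; apply/test_functionP; split => //; exact: Test_0. Qed.

Lemma normc_real (a : R) : `|a%:C| = `|a|%:C :> R[i].
Proof. by rewrite normc_def /= expr0n addr0 sqrtr_sqr. Qed.

Lemma distribution_real (f : functional R d) : schwartz_distribution f ->
  real_functional (fun u => f (fun x => (u x)%:C)).
Proof.
move=> [lin _].
have f0 : f (fun=> 0) = 0.
  have T := test_real (@Test_0 R d).
  transitivity (f (fun x => -1 * (0 : R)%:C + (0 : R)%:C)).
    by congr f; apply/funext => x; rewrite mulr0 addr0.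
  by rewrite (lin (-1) _ _ T T) mulN1r addNr.
split => [u w Hu Hw|c u Hu].
  rewrite -[X in _ = X + _]mul1r -lin; [|exact: test_real|exact: test_real].
  by congr f; apply/funext => x; rewrite mul1r rmorphD.
rewrite -[RHS]addr0 -f0 -lin; [|exact: test_real|exact: test_real (@Test_0 R d)].
by congr f; apply/funext => x; rewrite addr0 rmorphM.
Qed.

Lemma partials0 s : partials s (fun _ : V => 0 : R) = fun=> 0.
Proof. by elim: s => //= i s ->; exact: D_cst. Qed.

Lemma distribution_bounded (f : functional R d) : schwartz_distribution f ->
  functional_bounded (fun u => f (fun x => (u x)%:C)).
Proof.
move=> [_ bnd] A; have [C [N H]] := bnd _ (@compact_ball0 R d A).
exists `|C|, N; split => // u M Hu uA uM.
have M0 : 0 <= M := le_trans (normr_ge0 _) (uM [::] (leq0n _) 0).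
apply: (@le_trans _ _ (C * M)%:C); last by rewrite lecR ler_wpM2r// ler_norm.
apply: H; first exact: test_real.
  by apply: vanish_supp => x Ax; rewrite uA.
move=> s sN x; rewrite /cpartials.
have -> : Im_fun (fun x => (u x)%:C) = fun=> 0 by [].
by rewrite partials0 -/((_)%:C) normc_real lecR; exact: uM.
Qed.

Lemma distribution_split (f : functional R d) phi : schwartz_distribution f -> test_function phi ->
  f phi = f (fun x => (Re_fun phi x)%:C) + 'i * f (fun x => (Im_fun phi x)%:C).
Proof.
move=> [lin _] /test_functionP[rT iT].
rewrite addrC -lin; [|exact: test_real|exact: test_real].
by congr f; apply/funext => x; rewrite addrC [LHS]complexE.
Qed.

Lemma iter_dist_translate k y (f : functional R d) phi :
  iter k (dist_translate y) f phi = f (fun x => phi (x - k%:R *: y)).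
Proof.
elim: k phi => [|k IH] phi /=.
  by congr f; apply/funext => x; rewrite scale0r subr0.
rewrite /dist_translate IH; congr f; apply/funext => x; rewrite /translate.
by rewrite -addrA -opprD -natr1 scalerDl scale1r.
Qed.

Lemma eucl_norm_plane (a b delta : R) (i j : 'I_d) : i != j -> 0 < delta ->
  a ^+ 2 + b ^+ 2 = delta ^+ 2 -> eucl_norm (a *: E R i + b *: E R j) = delta.
Proof.
move=> ij d0 ab; rewrite /eucl_norm.
have -> : \sum_l (a *: E R i + b *: E R j) ord0 l ^+ 2 = a ^+ 2 + b ^+ 2.
  rewrite (bigD1 i)//= (bigD1 j) 1?eq_sym//= big1 => [|l /andP[li lj]].
    rewrite !mxE !eqxx (negPf ij) eq_sym (negPf ij) /=; ring.
  by rewrite !mxE eqxx (negPf li) (negPf lj) /=; ring.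
by rewrite ab sqrtr_sqr gtr0_norm.
Qed.

(** The circle in the plane of two distinct axes lies on the Euclidean sphere, so the hypothesis on
    f, tested on real functions, is the relation of order 0. *)
Lemma distribution_annihilates (f : functional R d) (q : {poly R[i]}) (delta : R) (i j : 'I_d) :
  i != j -> 0 < delta ->
  (forall y : V, eucl_norm y = delta -> dist_eq (poly_translate q y f) (fun=> 0)) ->
  annihilates (fun u => f (fun x => (u x)%:C)) i j delta (size q) 0 (fun k => q`_k).
Proof.
move=> ij d0 H a b u ab Hu /=.
apply: etrans (H _ (eucl_norm_plane ij d0 ab) _ (test_real Hu)); rewrite /poly_translate.
apply: eq_bigr => k _; rewrite iter_dist_translate; congr (_ * f _).
apply/funext => x; rewrite /moved; congr ((u (x + _))%:C).
by rewrite scalerDr !scalerA opprD !scaleNr.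
Qed.

End TestFunctions.

(** * Complex integrals and the polynomial form of the distribution *)

Section ComplexIntegral.
Variables (R : realType) (d : nat).
Local Notation V := 'rV[R]_d.
Implicit Types (phi psi g : V -> R[i]) (u w k : V -> R).

Definition continuousC g := continuous (Re_fun g) /\ continuous (Im_fun g).
Definition CcC phi := Cc (Re_fun phi) /\ Cc (Im_fun phi).
Definition integralC phi : R[i] := integral_rV (Re_fun phi) +i* integral_rV (Im_fun phi).

Lemma ReD (a b : R[i]) : complex.Re (a + b) = complex.Re a + complex.Re b.
Proof. by case: a b => [? ?] [? ?]. Qed.
Lemma ImD (a b : R[i]) : complex.Im (a + b) = complex.Im a + complex.Im b.
Proof. by case: a b => [? ?] [? ?]. Qed.
(** The difference is written as a sum with a multiple by -1, the form handled by [integral_rV_add]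
    and [integral_rV_scale]. *)
Lemma ReM (a b : R[i]) : complex.Re (a * b) =
  complex.Re a * complex.Re b + -1 * (complex.Im a * complex.Im b).
Proof. by case: a b => [? ?] [? ?] /=; rewrite mulN1r. Qed.
Lemma ImM (a b : R[i]) : complex.Im (a * b) =
  complex.Re a * complex.Im b + complex.Im a * complex.Re b.
Proof. by case: a b => [? ?] [? ?]. Qed.

Lemma Re_funD phi psi : Re_fun (fun x => phi x + psi x) = fun x => Re_fun phi x + Re_fun psi x.
Proof. by apply/funext => x; exact: ReD. Qed.
Lemma Im_funD phi psi : Im_fun (fun x => phi x + psi x) = fun x => Im_fun phi x + Im_fun psi x.
Proof. by apply/funext => x; exact: ImD. Qed.
Lemma Re_funM phi psi : Re_fun (fun x => phi x * psi x) =
  fun x => Re_fun phi x * Re_fun psi x + -1 * (Im_fun phi x * Im_fun psi x).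
Proof. by apply/funext => x; exact: ReM. Qed.
Lemma Im_funM phi psi : Im_fun (fun x => phi x * psi x) =
  fun x => Re_fun phi x * Im_fun psi x + Im_fun phi x * Re_fun psi x.
Proof. by apply/funext => x; exact: ImM. Qed.

Lemma CcC_add phi psi : CcC phi -> CcC psi -> CcC (fun x => phi x + psi x).
Proof. by move=> [? ?] [? ?]; rewrite /CcC Re_funD Im_funD; split; exact: Cc_add. Qed.

Lemma CcC_mul g phi : continuousC g -> CcC phi -> CcC (fun x => g x * phi x).
Proof.
move=> [rg ig] [rp ip]; rewrite /CcC Re_funM Im_funM; split.
  by apply: Cc_add; last apply: Cc_scale; exact: Cc_mul.
by apply: Cc_add; exact: Cc_mul.
Qed.

Lemma continuousC_cst (c : R[i]) : continuousC (fun=> c).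
Proof. by split; exact: cst_continuous. Qed.

Lemma continuousC_real k : continuous k -> continuousC (fun x => (k x)%:C).
Proof. by move=> kc; split => //; exact: cst_continuous. Qed.

Lemma continuousC_add g phi : continuousC g -> continuousC phi -> continuousC (fun x => g x + phi x).
Proof. by move=> [? ?] [? ?]; rewrite /continuousC Re_funD Im_funD; split; exact: add_cont. Qed.

Lemma continuousC_mul g phi : continuousC g -> continuousC phi -> continuousC (fun x => g x * phi x).
Proof.
move=> [? ?] [? ?]; rewrite /continuousC Re_funM Im_funM; split.
  by apply: add_cont; last apply: scale_cont; exact: mul_cont.
by apply: add_cont; exact: mul_cont.
Qed.

Lemma integralC_add phi psi : CcC phi -> CcC psi ->
  integralC (fun x => phi x + psi x) = integralC phi + integralC psi.
Proof.
by move=> [? ?] [? ?]; rewrite /integralC Re_funD Im_funD !integral_rV_add.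
Qed.

Lemma integralC_scale (c : R[i]) phi : CcC phi ->
  integralC (fun x => c * phi x) = c * integralC phi.
Proof.
move=> [rp ip]; rewrite /integralC Re_funM Im_funM.
rewrite (integral_rV_add (Cc_scale _ rp) (Cc_scale _ (Cc_scale _ ip))).
rewrite (integral_rV_add (Cc_scale _ ip) (Cc_scale _ rp)).
rewrite (integral_rV_scale _ (Cc_scale _ ip)) !integral_rV_scale//.
by case: c => a b /=; apply/eqP; rewrite eq_complex /= mulN1r !eqxx.
Qed.

Lemma test_CcC phi : test_function phi -> CcC phi.
Proof. by move=> /test_functionP[? ?]; split; exact: Test_Cc. Qed.

Lemma integralC_real_mul k phi : integralC (fun x => (k x)%:C * phi x) =
  (integral_rV (fun x => k x * Re_fun phi x))%:C +
  'i * (integral_rV (fun x => k x * Im_fun phi x))%:C.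
Proof.
rewrite [LHS]complexE /integralC /= Re_funM Im_funM.
congr ((_)%:C + _ * (_)%:C); congr integral_rV; apply/funext => x; rewrite /Re_fun /Im_fun /=.
  by rewrite mul0r mulr0 addr0.
by rewrite mul0r addr0.
Qed.

Definition poly_fun (M : nat) (c : {ffun 'I_d -> 'I_M} -> R[i]) : V -> R[i] :=
  fun x => \sum_f c f * (monomial f x)%:C.

Lemma poly_fun_ordinary M (c : {ffun 'I_d -> 'I_M} -> R[i]) : ordinary_polynomial (poly_fun c).
Proof.
have := meval_monomials c; congr ordinary_polynomial; apply/funext => x.
apply: eq_bigr => f _; rewrite rmorph_prod; congr (_ * _); apply: eq_bigr => i _.
by rewrite rmorphXn.
Qed.

Lemma poly_fun_continuous M (c : {ffun 'I_d -> 'I_M} -> R[i]) : continuousC (poly_fun c).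
Proof.
rewrite /poly_fun; elim: (index_enum _) => [|f r IH].
  by under eq_fun do rewrite big_nil; exact: continuousC_cst.
under eq_fun do rewrite big_cons; apply: continuousC_add => //.
by apply: continuousC_mul; [exact: continuousC_cst|exact/continuousC_real/monomial_cont].
Qed.

Lemma integralC_poly_fun M (c : {ffun 'I_d -> 'I_M} -> R[i]) phi : CcC phi ->
  dist_of_fun (poly_fun c) phi = \sum_f c f * integralC (fun x => (monomial f x)%:C * phi x).
Proof.
move=> Hp; rewrite -[LHS]/(integralC (fun x => poly_fun c x * phi x)) /poly_fun.
have Cm (f : {ffun 'I_d -> 'I_M}) : CcC (fun x => (monomial f x)%:C * phi x).
  by apply: CcC_mul => //; apply: continuousC_real; exact: monomial_cont.
have -> : (fun x => (\sum_(f : {ffun 'I_d -> 'I_M}) c f * (monomial f x)%:C) * phi x) =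
    fun x => \sum_(f : {ffun 'I_d -> 'I_M}) c f * ((monomial f x)%:C * phi x).
  by apply/funext => x; rewrite mulr_suml; apply: eq_bigr => f _; rewrite mulrA.
suff [] : CcC (fun x => \sum_(f : {ffun 'I_d -> 'I_M}) c f * ((monomial f x)%:C * phi x)) /\
  integralC (fun x => \sum_(f : {ffun 'I_d -> 'I_M}) c f * ((monomial f x)%:C * phi x)) =
  \sum_f c f * integralC (fun x => (monomial f x)%:C * phi x) by [].
elim: (index_enum _) => [|f r [CI IH]].
  rewrite big_nil; under eq_fun do rewrite big_nil.
  have z : Re_fun (fun _ : V => 0 : R[i]) = (fun=> 0) by [].
  have z' : Im_fun (fun _ : V => 0 : R[i]) = (fun=> 0) by [].
  rewrite /CcC /integralC z z' integral_rV_0; split => //; split; exact: Cc_0.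
have E : (fun x => \sum_(j <- f :: r) c j * ((monomial j x)%:C * phi x)) =
    fun x => c f * ((monomial f x)%:C * phi x) + \sum_(j <- r) c j * ((monomial j x)%:C * phi x).
  by apply/funext => x; rewrite big_cons.
have Cf : CcC (fun x => c f * ((monomial f x)%:C * phi x)).
  by apply: CcC_mul => //; exact: continuousC_cst.
rewrite E; split; first exact: CcC_add.
by rewrite integralC_add// integralC_scale// IH big_cons.
Qed.

Lemma distribution_polynomial (f : functional R d) (q : {poly R[i]}) (delta : R) :
  (1 < d)%N -> 0 < delta -> q != 0 -> schwartz_distribution f ->
  (forall y : V, eucl_norm y = delta -> dist_eq (poly_translate q y f) (fun=> 0)) ->
  exists (M : nat) (c : {ffun 'I_d -> 'I_M} -> R[i]), dist_eq f (dist_of_fun (poly_fun c)).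
Proof.
move=> d1 d0 q0 Sf Hf; have HF := distribution_real Sf; have Fb := distribution_bounded Sf.
pose m := (size q).-1; have sq : size q = m.+1 by rewrite prednK// size_poly_gt0.
have kills j u : Test u -> f (fun x => (iter m.*2 (D j) u x)%:C) = 0.
  move=> Hu.
  (* Here d > 1 enters: a second axis i is needed for e_j to be tangent at delta e_i. *)
  have [i ij] : exists i : 'I_d, i != j.
    have z : (0 < d)%N by exact: ltn_trans d1.
    case: (eqVneq j (Ordinal z)) => [->|]; last by rewrite eq_sym; exists (Ordinal z).
    by exists (Ordinal d1); rewrite -val_eqE.
  have := distribution_annihilates ij d0 Hf; rewrite sq => An.
  apply: (functional_kills_partials HF Fb _ _ An) => //; first by rewrite gt_eqF.
  by rewrite /m -[q`_ _]/(lead_coef q) lead_coef_eq0.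
have [c Hc] := functional_polynomial HF kills.
exists m.*2, c => phi Tp; have [rT iT] := (test_functionP phi).1 Tp.
rewrite (distribution_split Sf Tp) (Hc _ rT) (Hc _ iT) integralC_poly_fun; last exact: test_CcC.
rewrite mulr_sumr -big_split; apply: eq_bigr => a _ /=.
by rewrite integralC_real_mul; ring.
Qed.

End ComplexIntegral.

(** * Continuous functions as distributions *)

Section ContinuousFunctions.
Variables (R : realType) (d : nat).
Local Notation V := 'rV[R]_d.
Implicit Types (phi g : V -> R[i]) (k u : V -> R).

Lemma normc_i : `|'i%C| = 1 :> R[i].
Proof. by rewrite normc_def /= expr0n expr1n add0r sqrtr1. Qed.

(** Real and imaginary parts are 1-Lipschitz; the imaginary part of z is minus the real part of i
    z. *)
Lemma continuous_parts g : continuous (g : V -> R[i]^o) -> continuousC g.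
Proof.
move=> gc.
have cl (p : R[i] -> R) : (forall a b : R[i], (`|p a - p b|)%:C <= `|a - b|) ->
    continuous (fun x => p (g x)).
  move=> pl x; apply/(@cvgrPdist_le _ _ _ _ (nbhs_filter x)) => e e0.
  have e0' : 0 < e%:C by rewrite ltcR.
  have /cvgrPdist_le /(_ _ e0') := gc x.
  apply: (@filterS _ _ (nbhs_filter x)) => y H.
  by rewrite -lecR; apply: le_trans H; exact: pl.
split; apply: cl => a b.
  by have := normc_ge_Re (a - b); case: a b => [? ?] [? ?].
have -> : `|a - b| = `|(a - b) * 'i| by rewrite normrM normc_i mulr1.
by have := normc_ge_Re ((a - b) * 'i); rewrite ReiNIm normrN; case: a b => [? ?] [? ?].
Qed.

(** If k were positive somewhere, a bump supported where k is nonnegative would have a positive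
    integral against k; the same holds for -k. *)
Lemma continuous_eq0 k : continuous k ->
  (forall u, Test u -> integral_rV (fun x => k x * u x) = 0) -> forall x, k x = 0.
Proof.
have pos (h : V -> R) : continuous h -> (forall u, Test u -> integral_rV (fun x => h x * u x) = 0) ->
    forall x, h x <= 0.
  move=> hc H x; rewrite leNgt; apply/negP => hx.
  have [r r0 Hr] : exists2 r : R, 0 < r & forall y, `|x - y| < r -> 0 <= h y.
    have /cvgrPdist_le /(_ _ hx) /nbhs_normP[r /= r0 Hr] := hc x.
    by exists r => // y /Hr /=; rewrite ler_norml => /andP[_]; lra.
  have [u Hu [u0 ux uo]] := bump_rV x r0.
  have : 0 < integral_rV (fun y => h y * u y).
    apply: (@integral_rV_gt0 _ _ _ x); last exact: mulr_gt0.
      by apply: Cc_mul => //; exact: Test_Cc.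
    move=> y; have [xy|xy] := ltP `|x - y| r; first by rewrite mulr_ge0// Hr.
    by rewrite uo// mulr0.
  by rewrite H// ltxx.
move=> kc H x; apply/eqP; rewrite eq_le pos//=.
have mc : continuous (fun x => -1 * k x) by exact: scale_cont.
have := pos _ mc _ x; rewrite mulN1r oppr_le0; apply.
move=> u Hu; under eq_fun do rewrite -mulrA.
by rewrite integral_rV_scale ?H ?mulr0//; apply: Cc_mul => //; exact: Test_Cc.
Qed.

Lemma dist_of_fun_inj g h : continuousC g -> continuousC h ->
  dist_eq (dist_of_fun g) (dist_of_fun h) -> g = h.
Proof.
move=> [rg ig] [rh ih] H.
have key (a b : V -> R) : continuous a -> continuous b ->
    (forall u, Test u -> integral_rV (fun x => a x * u x) = integral_rV (fun x => b x * u x)) -> a = b.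
  move=> ac bc E; apply/funext => x; apply/eqP; rewrite -subr_eq0; apply/eqP.
  apply: (@continuous_eq0 (fun x => a x - b x)) => [|u Hu]; first exact: sub_cont.
  have Cu := Test_Cc Hu.
  have -> : (fun x => (a x - b x) * u x) = fun x => a x * u x + -1 * (b x * u x).
    by apply/funext => y; rewrite mulrBl mulN1r.
  rewrite integral_rV_add; [|exact: Cc_mul|exact/Cc_scale/Cc_mul].
  by rewrite integral_rV_scale ?E//; [rewrite mulN1r subrr|exact: Cc_mul].
have parts u : Test u ->
    integral_rV (fun x => Re_fun g x * u x) = integral_rV (fun x => Re_fun h x * u x) /\
    integral_rV (fun x => Im_fun g x * u x) = integral_rV (fun x => Im_fun h x * u x).
  move=> Hu; have := H _ (test_real Hu); rewrite /dist_of_fun !Re_funM !Im_funM => -[].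
  have r0 (p s : V -> R) : (fun x => p x * u x + -1 * (s x * 0)) = fun x => p x * u x.
    by apply/funext => x; rewrite !mulr0 addr0.
  have i0 (p s : V -> R) : (fun x => p x * 0 + s x * u x) = fun x => s x * u x.
    by apply/funext => x; rewrite mulr0 add0r.
  by rewrite /Re_fun /Im_fun /= !r0 !i0.
have RE : Re_fun g = Re_fun h by apply: key => // u /parts[].
have IE : Im_fun g = Im_fun h by apply: key => // u /parts[].
apply/funext => x; apply/eqP; rewrite eq_complex.
by rewrite -[complex.Re (g x)]/(Re_fun g x) -[complex.Im (g x)]/(Im_fun g x) RE IE !eqxx.
Qed.

Lemma dist_of_fun_distribution g : continuousC g -> schwartz_distribution (dist_of_fun g).
Proof.
move=> gc; split.
  move=> a phi psi /test_CcC Hp /test_CcC Hs.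
  rewrite -[LHS]/(integralC (fun x => g x * (a * phi x + psi x))).
  have -> : (fun x => g x * (a * phi x + psi x)) = fun x => a * (g x * phi x) + g x * psi x.
    by apply/funext => x; ring.
  have Gp := CcC_mul gc Hp; have Gs := CcC_mul gc Hs.
  rewrite integralC_add//; first by rewrite integralC_scale.
  by apply: CcC_mul => //; exact: continuousC_cst.
move=> K /compact_sub_ball[A A0 KA].
have bd (k : V -> R) : continuous k -> exists2 B, 0 <= B & forall x, `|x| <= A -> `|k x| <= B.
  move=> kc; have /compact_bounded[M [_ HM]] : compact (k @` [set x : V | `|x| <= A]).
    by apply: continuous_compact; [exact: continuous_subspaceT|exact: compact_ball0].
  exists (`|M| + 1); first by have := normr_ge0 M; lra.
  by move=> x xA; apply: (HM (`|M| + 1)); [have := ler_norm M; lra|exists x].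
have [B1 B10 HB1] := bd _ gc.1; have [B2 B20 HB2] := bd _ gc.2.
(* k M bounds the real and the imaginary part of the integral separately, hence k + k below; the
   order is 0. *)
pose k := (2 * A) ^+ d * (B1 + B2).
exists (k + k), 0%N => phi M Tp sK bM.
have pM x : `|phi x| <= M%:C.
  have := bM [::] isT x; rewrite /cpartials /=; suff -> : phi x = Re_fun phi x +i* Im_fun phi x by [].
  by rewrite /Re_fun /Im_fun; case: (phi x).
have rM x : `|Re_fun phi x| <= M.
  by have := le_trans (normc_ge_Re (phi x)) (pM x); rewrite lecR.
have iM x : `|Im_fun phi x| <= M.
  have := normc_ge_Re (phi x * 'i); rewrite ReiNIm normrN normrM.
  rewrite normc_i mulr1 => H.
  by have := le_trans H (pM x); rewrite lecR.
have M0 : 0 <= M := le_trans (normr_ge0 _) (rM 0).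
have pv : forall x, A < `|x| -> phi x = 0 by apply: supp_vanish => x /sK /KA.
have [[rc _] [ic _]] := CcC_mul gc (test_CcC Tp).
(* Applied with e = -1 to the real part of g phi and with e = 1 to its imaginary part. *)
have bound (p s t w : V -> R) (e : R) : `|e| = 1 ->
    continuous (fun x => p x * s x + e * (t x * w x)) ->
    (forall x, `|x| <= A -> `|p x| <= B1 /\ `|t x| <= B2) \/
    (forall x, `|x| <= A -> `|p x| <= B2 /\ `|t x| <= B1) ->
    (forall x, `|s x| <= M) -> (forall x, `|w x| <= M) ->
    (forall x, A < `|x| -> s x = 0 /\ w x = 0) ->
    `|integral_rV (fun x => p x * s x + e * (t x * w x))| <= k * M.
  move=> e1 cc pt sM wM off; rewrite /k -mulrA; apply: integral_rV_bound => //.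
    by move=> x /off[-> ->]; rewrite !mulr0 addr0.
  move=> x; have [xA|/off[-> ->]] := leP `|x| A; last first.
    by rewrite !mulr0 addr0 normr0 mulr_ge0// addr_ge0.
  apply: (le_trans (ler_normD _ _)); rewrite !normrM e1 mul1r mulrDl.
  by case: pt => /(_ x xA)[p1 t1]; last rewrite [leRHS]addrC; apply: lerD; apply: ler_pM.
rewrite -[dist_of_fun g phi]/(integralC (fun x => g x * phi x)) [integralC _]complexE.
apply: (le_trans (ler_normD _ _)); rewrite normrM normc_i mul1r.
rewrite !normc_real -rmorphD lecR mulrDl /integralC [complex.Re _]/= [complex.Im _]/=.
rewrite Re_funM Im_funM; apply: lerD.
  rewrite Re_funM in rc; apply: bound => //; first by rewrite normrN normr1.
    by left => x xA; split; [exact: HB1|exact: HB2].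
  by move=> x /pv E; rewrite /Re_fun /Im_fun E.
rewrite Im_funM in ic.
have E : (fun x => Re_fun g x * Im_fun phi x + Im_fun g x * Re_fun phi x) =
    fun x => Re_fun g x * Im_fun phi x + 1 * (Im_fun g x * Re_fun phi x).
  by apply/funext => x; rewrite mul1r.
rewrite E in ic *; apply: bound => //; first by rewrite normr1.
  by left => x xA; split; [exact: HB1|exact: HB2].
by move=> x /pv E'; rewrite /Re_fun /Im_fun E'.
Qed.

End ContinuousFunctions.

Unset Implicit Arguments.

Theorem theorem13 (R : realType) (d : nat) (hd : (1 < d)%N)
    (delta : R) (hdelta : 0 < delta) (q : {poly R[i]}) (hq : q != 0) :
  (forall f : functional R d, schwartz_distribution f ->
     (forall y : 'rV[R]_d, eucl_norm y = delta ->
        dist_eq (poly_translate q y f) (fun=> 0)) ->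
     dist_ordinary_polynomial f)
  /\
  (forall g : 'rV[R]_d -> R[i],
     continuous (g : 'rV[R]_d -> R[i]^o) ->
     (forall y : 'rV[R]_d, eucl_norm y = delta ->
        dist_eq (poly_translate q y (dist_of_fun g)) (fun=> 0)) ->
     ordinary_polynomial g).
Proof.
split=> [f Sf Hf|g /continuous_parts gc Hg].
  have [M [c Hc]] := distribution_polynomial hd hdelta hq Sf Hf.
  by exists (poly_fun c) => //; exact: poly_fun_ordinary.
(* The polynomial that g equals as a distribution is continuous as well, so the two functions agree
   at every point. *)
have [M [c Hc]] := distribution_polynomial hd hdelta hq (dist_of_fun_distribution gc) Hg.
rewrite (dist_of_fun_inj gc (poly_fun_continuous c) Hc).
exact: poly_fun_ordinary.
Qed.
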